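(* Assume $\tfrac12$-weak, $\tfrac12$-stable, GTM noise and let $\epsilon,\delta>0$ be sufficiently small. For any set $\mathsf{E}\subseteq\mathsf{P}^n$, an estimator $\hat{\boldsymbol p}_{\mathsf{E}}$ of $\boldsymbol p_{\mathsf{E}}=(p_a)_{a\in\mathsf{E}}$ satisfying $$\|\hat{\boldsymbol p}_{\mathsf{E}}-\boldsymbol p_{\mathsf{E}}\|_\infty\le O(\epsilon)(1-p_0)$$ with probability at least $1-\delta$ can be obtained from the output of $\mathbf{Ratio}(\mathsf{O},\mathsf{X},t)$ using a random set $\mathsf{X}\subseteq\mathsf{P}^n$ with $|\mathsf{X}|=\tfrac1{\epsilon^2}\log(4|\mathsf{E}|/\delta)$, any stabilizer covering $\mathsf{O}$ of $\mathsf{X}$, and $t=\tfrac1{\epsilon^2}\log(4|\mathsf{X}||\kappa|/\delta)$ measurements per round for $|\mathsf{O}|$ rounds.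
   Context: Pauli labels. Let $d=2^n$. $\mathsf{P}^n$ denotes the $n$-qubit Pauli group modulo phases, identified with $\mathbb{Z}_2^{2n}$: $a=(a_x,a_z)$ labels the Hermitian matrix $P_a=i^{a_x\cdot a_z}X[a_x]Z[a_z]$, where $A[v]=\bigotimes_iA^{v_i}$ and $X,Z$ are the single-qubit Pauli matrices. Let $\langle a,b\rangle=a_x\cdot b_z+a_z\cdot b_x\bmod2$. A stabilizer group is a subgroup of $\mathsf{P}^n$ on which $\langle\cdot,\cdot\rangle$ vanishes identically. A stabilizer covering of a set $\mathsf{X}\subseteq\mathsf{P}^n$ is a set $\mathsf{O}$ of stabilizer groups whose union contains $\mathsf{X}$. For a group $\mathsf{G}\subseteq\mathsf{P}^n$, $\mathsf{C_G}=\{a:\langle a,g\rangle=0\ \forall g\in\mathsf{G}\}$ and $\mathsf{A_G}=\mathsf{P}^n/\mathsf{C_G}$. Write $|a)=d^{-1/2}P_a$ as a vector in the Hilbert–Schmidt space with $(A|B)=\mathrm{Tr}(A^\dagger B)$; channels act as superoperators; $\mathcal{P}_a(M)=P_aMP_a^\dagger$. Noise model. GTM (gate-independent, time-stationary, Markovian) means: there is a fixed completely positive trace-preserving map $\Lambda$ such that the noisy implementation of every Pauli gate $\mathcal{P}_a$ is, at every time, $\mathcal{P}_a\Lambda$, and state preparations and measurements are described by fixed density operators and POVMs: $\tilde\rho_{\mathsf{G},0}$ is the noisy preparation of the stabilizer state $\frac1d\sum_{s\in\mathsf{G}}P_s$ of a stabilizer group $\mathsf{G}$, and $\{\tilde E_{\mathsf{G},b}:b\in\mathsf{A_G}\}$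 is the noisy syndrome measurement of $\mathsf{G}$. Pauli eigenvalues: $f_a=(a|\Lambda|a)$; $r_a=1-f_a$. Pauli error rates: $p_a=4^{-n}\sum_{b\in\mathsf{P}^n}(-1)^{\langle a,b\rangle}f_b$; $p_0$ is the probability of no error. $\tfrac12$-weak: $f_a\in[\tfrac12,1]$ for all $a\in\mathsf{P}^n$. $\tfrac12$-stable: each SPAM (state preparation and measurement) parameter $A_h=\sum_{b\in\mathsf{A_G}}(-1)^{\langle h,b\rangle}(\tilde E_{\mathsf{G},b}|h)(h|\Lambda|\tilde\rho_{\mathsf{G},0})$, $h\in\mathsf{G}$, satisfies $A_h\ge\tfrac12$. The random set $\mathsf{X}$ consists of elements of $\mathsf{P}^n$ sampled uniformly at random without replacement. $\kappa$ is the set of sequence lengths $m$ used by $\mathbf{Ratio}$. The implicit constant in $O(\epsilon)$ is absolute. $\mathbf{RunCB}(\mathsf{G},m)$ (one measurement): prepare $\tilde\rho_{\mathsf{G},0}$; for $i=0,\dots,m$ apply a noisy Pauli gate $P_{a_i}$ with $a_i\in\mathsf{P}^n$ uniformly random; perform the noisy syndrome measurement of $\mathsf{G}$ with outcome $b\in\mathsf{A_G}$; return $z\in\mathsf{A_G}$ with $z\equiv b+\sum_ia_i$. $\mathbf{V}(\mathsf{X}',\mathsf{G},t,m)$: call $\mathbf{RunCB}(\mathsf{G},m)$ $t$ times, getting $z_1,\dots,z_t$, and return the vector with entries $\frac1t\sum_{k=1}^t(-1)^{\langle x,z_k\rangle}$, $x\in\mathsf{X}'$. $\mathbf{Ratio}(\mathsf{O},\mathsf{X},t)$: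 set $\hat r_x=\mathrm{NaN}$ for all $x\in\mathsf{X}$ and $\mathsf{A}:=\emptyset$. For all $\mathsf{G}\in\mathsf{O}$: set $\mathsf{X}':=\mathsf{G}\setminus\mathsf{A}$, then $\mathsf{A}:=\mathsf{A}\cup\mathsf{G}$, $\hat V:=\mathbf{V}(\mathsf{X}',\mathsf{G},t,0)$ and $m:=1$; while there is $x\in\mathsf{X}'$ with $\hat r_x=\mathrm{NaN}$: set $\hat W:=\mathbf{V}(\mathsf{X}',\mathsf{G},t,m)$; for all $x\in\mathsf{X}'$ with $\hat r_x=\mathrm{NaN}$, put $v:=\hat V(x)$, $w:=\hat W(x)$, and if $w\le v/3$ and $w,v>0$ set $\hat r_x:=1-(w/v)^{1/m}$, else if $w\le0$ or $v\le0$ set $\hat r_x:=1$; then set $m:=2m$. Return $\hat{\boldsymbol r}_{\mathsf{X}}=(\hat r_x)_{x\in\mathsf{X}}$.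
   Formalization: Ratio never ends if some r_x=0 (e.g. 0∈X), and t depends on the run's own |κ|; so t uses any k≥1 for |κ|, and with probability ≥1−δ: if |κ|≤k the estimate is accurate, and if 2^k r_x≥c for all x∈X (c absolute) the run ends with |κ|≤k. |X|, t are rounded up. *)

(* Defs.v *)
From HB Require Import structures.
From mathcomp Require Import all_boot all_order all_algebra all_fingroup.
From mathcomp Require Import complex.
From mathcomp Require Import boolp reals exp.

Set Implicit Arguments.
Unset Strict Implicit.
Unset Printing Implicit Defensive.

Import Order.TTheory GRing.Theory Num.Theory.

Local Open Scope ring_scope.
Local Open Scope sesquilinear_scope.

(** * Pauli labels *)

(* The row vector (a_x | a_z).  The group library writes this additive group
   multiplicatively, so that in [{group pauli n}], [coset_of] and [coset] the
   product is the sum of labels. *)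
Definition pauli (n : nat) := 'rV['F_2]_(n + n).
HB.instance Definition _ n := GRing.Zmodule.on (pauli n).
HB.instance Definition _ n := FinGroup.on (pauli n).

Definition xpart n (a : pauli n) : 'rV['F_2]_n := lsubmx a.
Definition zpart n (a : pauli n) : 'rV['F_2]_n := rsubmx a.

Definition symp n (a b : pauli n) : 'F_2 :=
  \sum_i (xpart a 0 i * zpart b 0 i + zpart a 0 i * xpart b 0 i).

Definition symp_sign (R : pzRingType) n (a b : pauli n) : R :=
  (-1) ^+ (symp a b : nat).

Definition stabilizer_group n (G : {group pauli n}) : Prop :=
  forall a b, a \in G -> b \in G -> symp a b = 0.

(* The groups are listed in the order in which they will be visited. *)
Definition stabilizer_covering n (O : seq {group pauli n})
    (X : {set pauli n}) : Prop :=
  [/\ uniq O,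
      forall G, G \in O -> stabilizer_group G &
      forall x, x \in X -> exists2 G, G \in O & x \in G].

Definition commutant n (G : {group pauli n}) : {set pauli n} :=
  [set a | [forall g in G, symp a g == 0]].

(* The quotient of P^n by the commutant of G. *)
Definition syndrome n (G : {group pauli n}) := coset_of (commutant G).

(* (-1)^<x, z>; for x in G this does not depend on the representative of z. *)
Definition syndrome_sign (R : pzRingType) n (G : {group pauli n})
    (x : pauli n) (z : syndrome G) : R :=
  symp_sign R x (repr z).

(** * Operators on n qubits *)

(* The computational basis of n qubits is indexed by bit strings, so the
   dimension below equals 2 ^ n. *)
Definition qdim (n : nat) : nat := #|{: {ffun 'I_n -> 'I_2}}|.

Notation operator R n := ('M[R[i]]_(qdim n)).

Section Operators.
Variables (R : realType) (n : nat).
Local Notation C := R[i].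

Definition bitstring (s : 'I_(qdim n)) : {ffun 'I_n -> 'I_2} := enum_val s.

Definition sigma_x : 'M[C]_2 := \matrix_(i, j) (i != j)%:R.
Definition sigma_z : 'M[C]_2 := \matrix_(i, j) ((-1) ^+ i *+ (i == j)).

(* A[v], the tensor product of the A ^ v_i. *)
Definition tensor_power (A : 'M[C]_2) (v : 'rV['F_2]_n) : operator R n :=
  \matrix_(s, t)
    \prod_i ((A ^+ (v 0 i : nat)) (bitstring s i) (bitstring t i)).

(* The exponent of the imaginary unit is the dot product over the integers,
   not modulo 2. *)
Definition pauli_mx (a : pauli n) : operator R n :=
  'i ^+ (\sum_(i < n) (xpart a 0%R i : nat) * (zpart a 0%R i : nat))%N
    *: (tensor_power sigma_x (xpart a) *m tensor_power sigma_z (zpart a)).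

Definition pauli_gate (a : pauli n) (M : operator R n) : operator R n :=
  pauli_mx a *m M *m (pauli_mx a)^t*.

(* (A|B) *)
Definition hs (A B : operator R n) : C := \tr (A^t* *m B).

(* |a) *)
Definition ket (a : pauli n) : operator R n :=
  (sqrtC (qdim n)%:R)^-1 *: pauli_mx a.

(* In the order of R[i], [0 <= z] means that z is real and nonnegative. *)
Definition psd m (A : 'M[C]_m) : Prop :=
  forall v : 'cV[C]_m, 0 <= (v^t* *m A *m v) 0 0.

Definition density (rho : operator R n) : Prop := psd rho /\ \tr rho = 1.

Definition povm (I : finType) (E : I -> operator R n) : Prop :=
  (forall b, psd (E b)) /\ \sum_b E b = 1%:M.

Definition completely_positive (L : operator R n -> operator R n) : Prop :=
  forall (k : nat) (B : 'I_k -> 'I_k -> operator R n),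
    psd (\mxblock_(i < k, j < k) B i j) ->
    psd (\mxblock_(i < k, j < k) L (B i j)).

Definition trace_preserving (L : operator R n -> operator R n) : Prop :=
  forall M, \tr (L M) = \tr M.

End Operators.

(** * Gate-independent, time-stationary, Markovian noise *)

Record gtm_noise (R : realType) (n : nat) := GTMNoise {
  channel : {linear operator R n -> operator R n};
  channel_cp : completely_positive channel;
  channel_tp : trace_preserving channel;
  prep : {group pauli n} -> operator R n;
  prep_density : forall G, stabilizer_group G -> density (prep G);
  meas : forall G : {group pauli n}, syndrome G -> operator R n;
  meas_povm : forall G, stabilizer_group G -> povm (@meas G)
}.

Section Noise.
Variables (R : realType) (n : nat) (noise : gtm_noise R n).
Local Notation Lambda := (channel noise).

Definition noisy_gate (a : pauli n) (rho : operator R n) : operator R n :=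
  pauli_gate a (Lambda rho).

(* The quantities passed to [complex.Re] here are real because Lambda preserves
   Hermiticity and states and effects are Hermitian. *)
Definition eigenvalue_of (a : pauli n) : R :=
  complex.Re (hs (ket R a) (Lambda (ket R a))).

Definition infidelity_of (a : pauli n) : R := 1 - eigenvalue_of a.

Definition error_rate (a : pauli n) : R :=
  4 ^- n * \sum_(b : pauli n) symp_sign R a b * eigenvalue_of b.

Definition spam (G : {group pauli n}) (h : pauli n) : R :=
  complex.Re (\sum_(b : syndrome G)
    syndrome_sign R[i] h b * hs (meas noise b) (ket R h)
      * hs (ket R h) (Lambda (prep noise G))).

Definition weak (theta : R) : Prop :=
  forall a, theta <= eigenvalue_of a <= 1.

Definition stable (theta : R) : Prop :=
  forall G, stabilizer_group G -> forall h, h \in G -> theta <= spam G h.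

End Noise.

(** * Finitary random computations *)

(* A computation making finitely many random choices is represented by its
   expectation functional, mapping f to the expectation of f(outcome). *)
Definition random (R : Type) (A : Type) : Type := (A -> R) -> R.

Section Random.
Variable R : realType.

Definition ret A (a : A) : random R A := fun f => f a.

Definition bind A B (m : random R A) (g : A -> random R B) : random R B :=
  fun f => m (fun a => g a f).

Definition uniform (T : finType) (S : {set T}) : random R T :=
  fun f => #|S|%:R^-1 * \sum_(x in S) f x.

Definition probability A (m : random R A) (event : A -> Prop) : R :=
  m (fun a => (`[< event a >])%:R).

End Random.

Notation "x <-$ m ;; f" := (bind m (fun x => f))
  (at level 61, m at next level, right associativity).
Notation "' p <-$ m ;; f" := (bind m (fun x => let: p := x in f))
  (at level 61, p pattern, m at next level, right associativity).

(* k independent repetitions *)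
Fixpoint repeat (R : realType) A (m : random R A) (k : nat)
    : random R (seq A) :=
  if k is k'.+1 then a <-$ m ;; s <-$ repeat m k' ;; ret (a :: s)
  else ret [::].

(** * The estimation protocol *)

Section Protocol.
Variables (R : realType) (n : nat) (noise : gtm_noise R n).

(* Born's rule *)
Definition measure (G : {group pauli n}) (rho : operator R n)
    : random R (syndrome G) :=
  fun f => \sum_(b : syndrome G) complex.Re (hs (meas noise b) rho) * f b.

(* Apply k uniformly random noisy Pauli gates, and add up their labels. *)
Fixpoint random_gates (k : nat) (rho : operator R n) (s : pauli n)
    : random R (operator R n * pauli n) :=
  if k is k'.+1 then
    a <-$ uniform [set: pauli n] ;;
    random_gates k' (noisy_gate noise a rho) (s + a)
  else ret (rho, s).

Definition run_cb (G : {group pauli n}) (m : nat) : random R (syndrome G) :=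
  '(rho, s) <-$ random_gates m.+1 (prep noise G) 0 ;;
  b <-$ measure rho ;;
  ret (b * (coset (commutant G) s : syndrome G))%g.

(* The returned vector is indexed by X' and extended by 0. *)
Definition run_v (X' : {set pauli n}) (G : {group pauli n}) (t m : nat)
    : random R (pauli n -> R) :=
  zs <-$ repeat (@run_cb G m) t ;;
  ret (fun x => if x \in X' then
                  t%:R^-1 * \sum_(z <- zs) syndrome_sign R x z
                else 0).

(* [None] stands for NaN. *)
Definition estimate := pauli n -> option R.

Definition ratio_step (m : nat) (v w : R) : option R :=
  if [&& w <= v / 3, 0 < w & 0 < v] then Some (1 - (w / v) `^ (m%:R^-1))
  else if (w <= 0) || (v <= 0) then Some 1
  else None.

(* The state carries the estimates and the list kappa of the sequence lengths
   used so far.  [fuel] bounds the number of passes through the loop, and the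
   outcome is [None] if this bound is exceeded: every event concerning runs
   with at most [fuel] passes has the probability it has for the unbounded
   loop. *)
Fixpoint ratio_while (fuel : nat) (X X' : {set pauli n}) (G : {group pauli n})
    (t : nat) (v : pauli n -> R) (m : nat) (r : estimate) (kappa : seq nat)
    : random R (option (estimate * seq nat)) :=
  let pending := [set x in X' :&: X | r x == None] in
  if pending == set0 then ret (Some (r, kappa))
  else if fuel is fuel'.+1 then
    w <-$ run_v X' G t m ;;
    ratio_while fuel' X X' G t v (2 * m)
      (fun x => if x \in pending then ratio_step m (v x) (w x) else r x)
      (m :: kappa)
  else ret None.

(* A is the union of the groups visited so far. *)
Fixpoint ratio_rounds (fuel : nat) (O : seq {group pauli n})
    (X A : {set pauli n}) (t : nat) (r : estimate) (kappa : seq nat)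
    : random R (option (estimate * seq nat)) :=
  if O is G :: O' then
    let X' := G :\: A in
    v <-$ run_v X' G t 0 ;;
    out <-$ ratio_while fuel X X' G t v 1 r (0%N :: kappa) ;;
    if out is Some (r', kappa') then
      ratio_rounds fuel O' X (A :|: G) t r' kappa'
    else ret None
  else ret (Some (r, kappa)).

(* Entries outside X are never assigned, hence remain [None]. *)
Definition ratio (fuel : nat) (O : seq {group pauli n}) (X : {set pauli n})
    (t : nat) : random R (option (estimate * seq nat)) :=
  ratio_rounds fuel O X set0 t (fun=> None) [::].

(* [K] elements sampled uniformly without replacement form a uniformly random
   K-subset. *)
Definition experiment (fuel K t : nat)
    (O : {set pauli n} -> seq {group pauli n})
    : random R ({set pauli n} * option (estimate * seq nat)) :=
  X <-$ uniform [set X : {set pauli n} | #|X| == K] ;;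
  out <-$ ratio fuel (O X) X t ;;
  ret (X, out).

End Protocol.

Definition num_lengths (kappa : seq nat) : nat := size (undup kappa).

(* The least natural number that is at least x, for x >= 0. *)
Definition ceiln (R : realType) (x : R) : nat := `|Num.ceil x|%N.

Definition sup_dist (R : realType) n (E : {set pauli n}) (p q : pauli n -> R)
    : R := \big[Num.max/0]_(a in E) `|p a - q a|.

(* Main.v *)
(** The infidelities satisfy [p_a = [a = 0] - avg_x (-1)^<a,x> r_x], so the
    average over the random set X, with the output of Ratio in place of [r_x],
    estimates [p_a].  Complete positivity gives [p_a >= 0], hence
    [0 <= r_x <= 2 (1 - p_0)]: the sampling error is O(eps) (1 - p_0) by a
    Chernoff bound for sampling without replacement, and it remains to estimate
    each [r_x] up to a factor 1 + O(eps).

    Averaging over the Pauli gates projects every noise step onto [|x)], so the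
    sign returned by RunCB has expectation [A_x f_x^m].  When the data used for x
    in the first k lengths are accurate up to s = 6 eps, the loop stops for x at
    a length m with [f_x^m] between 1/36 and 1/2; there 1/m = O(r_x), and the
    m-th root turns an error O(s) on [f_x^m] into an error O(s) r_x on [r_x].
    A union bound over |X| elements and k lengths controls the bad events; a
    run exceeding k lengths can only violate the last clause, and when every
    [2^k r_x >= 20], accurate data exclude such a run. *)
From HB Require Import structures.
Require Import Defs.
From mathcomp Require Import all_boot all_order all_algebra all_fingroup.
From mathcomp Require Import complex.
From mathcomp Require Import boolp reals exp.
From mathcomp Require Import ring lra sequences.
Import Order.TTheory GRing.Theory Num.Theory.
Local Open Scope ring_scope.

Set Implicit Arguments.
Unset Strict Implicit.
Unset Printing Implicit Defensive.

(** * Random computations and concentration *)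

(** The data are adaptive: whether and at which lengths an element is examined depends on earlier
    outcomes. So no product probability space is formed; the expectation of the failure indicator is
    pushed through the protocol, and each call of [run_v] pays for its bad event before the rest is
    bounded on good data. Only elements of X are charged, and each only in the first group of the
    covering that contains it, since later rounds remove the groups already visited; hence |X| k
    terms suffice, whatever the number of groups. The choice s = 6 eps makes the tail exponent s^2 t
    / 32 at least eps^2 t, so the bare logarithms in |X| and t are enough. A [random] is an
    arbitrary functional, hence linearity, positivity and normalization have to be carried along;
    they may fail, for example, when an operator that is not a density is measured. *)

Definition expectation (R : realType) A (m : random R A) : Prop :=
  [/\ forall f g, m (fun a => f a + g a) = m f + m g,
      forall c f, m (fun a => c * f a) = c * m f,
      forall f, (forall a, 0 <= f a) -> 0 <= m f &
      m (fun=> 1) = 1].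

Section Expectation.
Variable R : realType.

Lemma expectation_cst A (m : random R A) c :
  expectation m -> m (fun=> c) = c.
Proof.
move=> [_ mZ _ m1].
by rewrite -[RHS]mulr1 -[in RHS]m1 -mZ; congr m; apply/funext => a; rewrite mulr1.
Qed.

Lemma expectation_le A (m : random R A) (f g : A -> R) :
  expectation m -> (forall a, f a <= g a) -> m f <= m g.
Proof.
move=> [mD mZ m_ge0 _] fg; rewrite -subr_ge0.
have -> : m g - m f = m (fun a => g a - f a).
  rewrite mD -mulN1r -mZ; congr (_ + m _).
  by apply/funext => a; rewrite mulN1r.
by apply: m_ge0 => a; rewrite subr_ge0.
Qed.

Lemma expectation_sum A (I : Type) (s : seq I) (m : random R A)
    (F : I -> A -> R) :
  expectation m -> m (fun a => \sum_(i <- s) F i a) = \sum_(i <- s) m (F i).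
Proof.
move=> mE; have [mD _ _ _] := mE; elim: s => [|i s IHs].
  by under eq_fun do rewrite big_nil; rewrite big_nil expectation_cst.
by under eq_fun do rewrite big_cons; rewrite big_cons mD IHs.
Qed.

Lemma expectation_ret A (a : A) : expectation (@ret R A a).
Proof. by split=> // f; apply. Qed.

Lemma expectation_bind A B (m : random R A) (g : A -> random R B) :
  expectation m -> (forall a, expectation (g a)) -> expectation (bind m g).
Proof.
move=> [mD mZ m_ge0 m1] gE; split; rewrite /bind.
- move=> f h; rewrite -mD; congr m; apply/funext => a; by have [-> _ _ _] := gE a.
- move=> c f; rewrite -mZ; congr m; apply/funext => a; by have [_ -> _ _] := gE a.
- move=> f f_ge0; apply: m_ge0 => a; by have [_ _ + _] := gE a; apply.
- rewrite -[RHS]m1; congr m; apply/funext => a; by have [_ _ _ ->] := gE a.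
Qed.

Lemma bind_le A B (m : random R A) (g : A -> random R B) (h : B -> R) c :
  expectation m -> (forall a, g a h <= c) -> bind m g h <= c.
Proof.
by move=> mE gc; rewrite /bind -(expectation_cst c mE); apply: expectation_le.
Qed.

Lemma expectation_uniform (T : finType) (S : {set T}) :
  (0 < #|S|)%N -> expectation (@uniform R T S).
Proof.
move=> S_gt0; split; rewrite /uniform.
- by move=> f g; rewrite big_split mulrDr.
- by move=> c f; rewrite -mulr_sumr mulrCA.
- by move=> f f_ge0; rewrite mulr_ge0 ?invr_ge0 ?ler0n ?sumr_ge0.
- by rewrite sumr_const mulVf // pnatr_eq0 -lt0n.
Qed.

Lemma expectation_repeat A (m : random R A) t :
  expectation m -> expectation (repeat m t).
Proof.
move=> mE; elim: t => [|t IHt] /=; first exact: expectation_ret.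
apply: expectation_bind => // a; apply: expectation_bind => // s.
exact: expectation_ret.
Qed.

Lemma probability_le1 A (m : random R A) P :
  expectation m -> probability m P <= 1.
Proof.
move=> mE; have [_ _ _ <-] := mE; apply: expectation_le => // a.
by case: (asbool _).
Qed.

Lemma probabilityC A (m : random R A) P :
  expectation m -> probability m (fun a => ~ P a) = 1 - probability m P.
Proof.
move=> mE; have [mD _ _ m1] := mE; apply/eqP; rewrite eq_sym subr_eq -m1 -mD.
apply/eqP; congr m; apply/funext => a; rewrite asbool_neg.
by case: (asbool _); rewrite ?add0r ?addr0.
Qed.

Lemma probability_union A (I : finType) (S : {set I}) (m : random R A)
    (P : I -> A -> Prop) q :
  expectation m -> (forall i, i \in S -> probability m (P i) <= q) ->
  probability m (fun a => exists2 i, i \in S & P i a) <= #|S|%:R * q.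
Proof.
move=> mE Pq; apply: (@le_trans _ _ (\sum_(i in S) probability m (P i))); last first.
  by rewrite mulr_natl -sumr_const; apply: ler_sum.
rewrite /probability -[leRHS]big_enum -expectation_sum //.
apply: expectation_le => // a; rewrite big_enum /=.
case: asboolP => [[i iS Pia]|_]; last by apply: sumr_ge0 => i _; apply: ler0n.
by rewrite (bigD1 i) //= (asboolT Pia) lerDl sumr_ge0 // => j _; apply: ler0n.
Qed.

(* (1 - u) (1 + u + 2 u^2) = 1 + u^2 (1 - 2 u) >= 1 and expR (- u) >= 1 - u. *)
Lemma expR_le_quadratic (u : R) : u <= 1 / 2 -> expR u <= 1 + u + 2 * u ^+ 2.
Proof.
move=> u12; have e1 := expR_ge1Dx (- u).
rewrite expRN in e1; have e0 := expR_gt0 u.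
have h : (1 - u) * expR u <= 1 by rewrite -ler_pdivlMr // mul1r.
have u1 : 0 < 1 - u by lra.
rewrite -(ler_pM2l u1); apply: (le_trans h); rewrite -subr_ge0.
have -> : (1 - u) * (1 + u + 2 * u ^+ 2) - 1 = u ^+ 2 * (1 - 2 * u) by ring.
by rewrite mulr_ge0 ?sqr_ge0 //; lra.
Qed.

Lemma expectation_norm_le1 A (m : random R A) (X : A -> R) :
  expectation m -> (forall a, `|X a| <= 1) -> `|m X| <= 1.
Proof.
move=> mE X1; rewrite ler_norml -{1}(expectation_cst (-1) mE) -{2}(expectation_cst 1 mE).
by apply/andP; split; apply: expectation_le => // a; have := X1 a; rewrite ler_norml => /andP[].
Qed.

(** Centering removes the linear term of [expR_le_quadratic]; since |X - m X| <= 2, the quadratic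
    term is at most 8 l^2, and |l| <= 1/4 keeps the argument at most 1/2. *)
Lemma centered_mgf_le A (m : random R A) (X : A -> R) (l : R) :
  expectation m -> (forall a, `|X a| <= 1) -> `|l| <= 1 / 4 ->
  m (fun a => expR (l * (X a - m X))) <= expR (8 * l ^+ 2).
Proof.
move=> mE X1 l14; have mX1 := expectation_norm_le1 mE X1.
have [mD mZ _ _] := mE.
set mu := m X in mX1 *.
have D2 a : `|X a - mu| <= 2.
  by apply: le_trans (ler_normB _ _) _; have := X1 a; lra.
have lD a : `|l * (X a - mu)| <= 1 / 2.
  rewrite normrM; apply: (@le_trans _ _ (1/4 * 2)); last lra.
  by apply: ler_pM.
apply: (@le_trans _ _ (m (fun a => l * (X a - mu) + (1 + 8 * l ^+ 2)))).
  apply: expectation_le => // a.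
  apply: le_trans (expR_le_quadratic _) _.
    by apply: le_trans (ler_norm _) (lD a).
  have : (X a - mu) ^+ 2 <= 4.
    by have := D2 a; rewrite ler_norml => /andP[? ?]; nra.
  rewrite exprMn; have := sqr_ge0 l; nra.
rewrite mD mZ mD -/mu !(expectation_cst _ mE) subrr mulr0 add0r.
exact: expR_ge1Dx.
Qed.

Lemma repeat_mgf_le A (m : random R A) (X : A -> R) t (l : R) :
  expectation m -> (forall a, `|X a| <= 1) -> `|l| <= 1 / 4 ->
  repeat m t (fun s => expR (l * \sum_(a <- s) (X a - m X)))
    <= expR (8 * l ^+ 2 * t%:R).
Proof.
move=> mE X1 l14; have [_ mZ _ _] := mE.
elim: t => [|t IHt] /=.
  by rewrite /ret big_nil !mulr0.
rewrite /bind /ret.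
have -> : (fun a => repeat m t (fun s =>
     expR (l * \sum_(i <- a :: s) (X i - m X)))) =
  (fun a => repeat m t (fun s => expR (l * \sum_(i <- s) (X i - m X)))
     * expR (l * (X a - m X))).
  apply/funext => a; have [_ rZ _ _] := expectation_repeat t mE.
  rewrite mulrC -rZ; congr (repeat m t _); apply/funext => s.
  by rewrite big_cons mulrDr expRD.
rewrite mZ -[t.+1]addn1 natrD mulrDr mulr1 expRD; apply: ler_pM => //.
- have [_ _ r0 _] := expectation_repeat t mE; apply: r0 => s; exact: expR_ge0.
- have [_ _ m0 _] := mE; apply: m0 => a; exact: expR_ge0.
- exact: centered_mgf_le.
Qed.

(** The bound on the moment generating function is a hypothesis, so that one tail estimate serves
    both independent repetitions and sampling without replacement. *)
Lemma chernoff A (m : random R A) (Y : A -> R) (v s : R) :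
  expectation m -> 0 <= s <= 4 ->
  (forall l, `|l| <= 1 / 4 -> m (fun a => expR (l * Y a)) <= expR (8 * l ^+ 2 * v)) ->
  probability m (fun a => ~ (`|Y a| <= s * v)) <= 2 * expR (- (s ^+ 2 * v / 32)).
Proof.
move=> mE /andP[s0 s4] mgf; have [mD mZ _ _] := mE.
(* For positive v this minimizes 8 l^2 v - l s v, with value - s^2 v / 32; s <= 4 keeps l in the
   allowed range. *)
pose l := s / 16.
have l14 : `|l| <= 1 / 4 by rewrite ger0_norm /l; lra.
apply: (@le_trans _ _ (m (fun a => expR (- (l * s * v)) * (expR (l * Y a) + expR (- l * Y a))))).
  apply: expectation_le => // a; case: asboolP => [/negP|_] /=; last first.
    by rewrite mulr_ge0 ?addr_ge0 ?expR_ge0.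
  rewrite -ltNge mulrDr -!expRD => Ysv.
  have [Y0|Y0] := leP 0 (Y a).
    rewrite ger0_norm // in Ysv; apply: ler_wpDr; first exact: expR_ge0.
    rewrite -[leLHS]expR0 ler_expR -mulrA addrC -mulrBr mulr_ge0 // /l; first by lra.
    by rewrite subr_ge0 ltW.
  rewrite ltr0_norm // in Ysv; apply: ler_wpDl; first exact: expR_ge0.
  rewrite -[leLHS]expR0 ler_expR mulNr -mulrN -mulrA addrC -mulrBr mulr_ge0 // /l; first by lra.
  by rewrite subr_ge0 ltW.
rewrite mZ mD; apply: (@le_trans _ _ (expR (- (l * s * v)) * (2 * expR (8 * l ^+ 2 * v)))).
  rewrite ler_wpM2l ?expR_ge0 // mulr_natl mulr2n lerD ?mgf //.
  by rewrite -(sqrrN l) mgf // normrN.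
rewrite mulrCA -expRD le_eqVlt; apply/orP; left; apply/eqP; congr (2 * expR _).
by rewrite /l; field.
Qed.

Lemma eq_repeat A (m : random R A) t (f g : seq A -> R) :
  (forall z, size z = t -> f z = g z) -> repeat m t f = repeat m t g.
Proof.
elim: t f g => [|t IHt] f g fg /=; first by rewrite /ret fg.
rewrite /bind /ret; congr m; apply/funext => a.
by apply: IHt => z zt; rewrite fg //= zt.
Qed.

Lemma repeat_concentration A (m : random R A) (X : A -> R) t s :
  expectation m -> (forall a, `|X a| <= 1) -> 0 <= s <= 4 ->
  probability (repeat m t)
    (fun z => ~ (`|t%:R^-1 * \sum_(a <- z) X a - m X| <= s))
    <= 2 * expR (- (s ^+ 2 * t%:R / 32)).
Proof.
(* For t = 0 the claimed bound is 2, hence trivial. *)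
move=> mE X1 s04; have [->|] := posnP t.
  rewrite mulr0 mul0r oppr0 expR0 mulr1.
  apply: le_trans (probability_le1 _ (expectation_repeat 0 mE)) _.
  by rewrite ler1n.
rewrite -(ltr0n R) => t0; apply: le_trans (chernoff (expectation_repeat t mE) s04
  (fun l => @repeat_mgf_le _ m X t l mE X1)).
rewrite le_eqVlt; apply/orP; left; apply/eqP; apply: eq_repeat => z zt.
congr (asbool (~ is_true _))%:R.
rewrite sumrB big_const_seq count_predT zt iter_addr_0 -ler_pdivrMr //.
rewrite -[X in _ / X <= _](gtr0_norm t0) -normf_div; congr (`| _ | <= _).
by rewrite -mulr_natr; field; rewrite gt_eqF.
Qed.

End Expectation.

(** * Elementary symmetric means and sampling without replacement *)

Section ElementarySymmetric.
Variables (R : realFieldType) (T : finType) (y : T -> R).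
Hypothesis y_ge0 : forall x, 0 <= y x.
Implicit Types (X : {set T}).

Let esym k := \sum_(X : {set T} | #|X| == k) \prod_(x in X) y x.

(* Exchanging x and x' adds up pairs of terms to a square. *)
Lemma esym_swap_ge0 k :
  0 <= \sum_(p : {set T} * T * T | (#|p.1.1| == k) && (p.1.2 \in p.1.1) && (p.2 \notin p.1.1))
         (\prod_(z in p.1.1) y z) * (y p.1.2 - y p.2).
Proof.
pose h (p : {set T} * T * T) := (tperm p.1.2 p.2 @: p.1.1, p.2, p.1.2).
have hK : involutive h.
  move=> [[X x] x'] /=; rewrite /h /= tpermC -imset_comp.
  by rewrite (eq_imset (g := id)) ?imset_id // => z /=; rewrite tpermK.
set S := (X in 0 <= X).
suff : 0 <= S + S by lra.
rewrite {2}/S (reindex_inj (inv_inj hK)) /=.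
have imE X x x' z : (z \in tperm x x' @: X) = (tperm x x' z \in X).
  by rewrite -{1}[z](tpermK x x') mem_imset //; exact: perm_inj.
rewrite (eq_bigl (fun p : {set T} * T * T =>
    (#|p.1.1| == k) && (p.1.2 \in p.1.1) && (p.2 \notin p.1.1))); last first.
  move=> [[X x] x'] /=; rewrite !imE tpermR tpermL card_imset //.
  exact: perm_inj.
rewrite -big_split /=; apply: sumr_ge0 => -[[X x] x'] /= /andP[/andP[_ xX] x'X].
rewrite big_imset /=; last by move=> ? ? _ _; apply: perm_inj.
rewrite (bigD1 x) //= [X in _ + X * _](bigD1 x) //= tpermL.
rewrite [X in _ + y x' * X * _](eq_bigr y) => [|z /andP[zX zx]]; last first.
  by rewrite tpermD // eq_sym //; apply: contraNneq x'X => <-.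
set P := \prod_(_ in _ | _) _.
have -> : y x * P * (y x - y x') + y x' * P * (y x' - y x) = P * (y x - y x') ^+ 2.
  by ring.
by rewrite mulr_ge0 ?sqr_ge0 // prodr_ge0.
Qed.

(** Double counting of pairs of a (k+1)-subset and one of its elements: removing the element leaves
    a k-subset and a point outside it. *)
Lemma esymS k :
  k.+1%:R * esym k.+1 =
  \sum_(X : {set T} | #|X| == k) (\prod_(z in X) y z) * \sum_(x in ~: X) y x.
Proof.
transitivity (\sum_(p : {set T} * T | (#|p.1| == k.+1) && (p.2 \in p.1)) \prod_(z in p.1) y z).
  rewrite -(pair_big_dep (fun X : {set T} => #|X| == k.+1) (fun X x => x \in X)
     (fun X x => \prod_(z in X) y z)) /=.
  rewrite mulr_sumr; apply: eq_bigr => X /eqP Xk.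
  by rewrite sumr_const Xk mulr_natl.
rewrite (reindex_onto (fun p : {set T} * T => (p.2 |: p.1, p.2))
    (fun p : {set T} * T => (p.1 :\ p.2, p.2))) /=; last first.
  by move=> [X x] /= /andP[_ xX]; rewrite setD1K.
under [RHS]eq_bigr => X _ do rewrite mulr_sumr.
rewrite pair_big_dep /=; apply: eq_big => [[X x] /=|[X x] /= /andP[_]].
  rewrite setU11 andbT inE xpair_eqE eqxx andbT.
  have [xX|xX] := boolP (x \in X); last by rewrite setU1K // eqxx cardsU1 xX add1n eqSS.
  rewrite andbF; apply/negbTE; rewrite negb_and; apply/orP; right.
  by apply: contraTneq xX => <-; rewrite !inE eqxx.
rewrite xpair_eqE eqxx andbT => /eqP XE.
have xX : x \notin X by rewrite -XE setD11.
by rewrite (big_setU1 _ xX) mulrC.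
Qed.

(** Splitting the sum of y over X and its complement writes (\sum_x y x) e_k as U + V with V = (k+1)
    e_(k+1), and the exchange inequality says k V <= (|T| - k) U. *)
Lemma esym_step k : (k <= #|T|)%N ->
  #|T|%:R * (k.+1%:R * esym k.+1) <= (#|T| - k)%:R * (\sum_x y x) * esym k.
Proof.
move=> kT; rewrite esymS.
set V := (X in _ * X <= _).
pose U := \sum_(X : {set T} | #|X| == k) (\prod_(z in X) y z) * \sum_(x in X) y x.
have UV : (\sum_x y x) * esym k = U + V.
  rewrite -big_split mulr_sumr; apply: eq_bigr => X _ /=.
  rewrite -mulrDr mulrC; congr (_ * _).
  by rewrite (bigID (mem X)) /=; congr (_ + _); apply: eq_bigl => x; rewrite inE.
have := esym_swap_ge0 k.
rewrite -(pair_big_dep (fun p : {set T} * T => (#|p.1| == k) && (p.2 \in p.1)) 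
  (fun p x => x \notin p.1) (fun p x => (\prod_(z in p.1) y z) * (y p.2 - y x))) /=.
rewrite -(pair_big_dep (fun X : {set T} => #|X| == k) (fun X x => x \in X)
     (fun X x => \sum_(x' | x' \notin X) (\prod_(z in X) y z) * (y x - y x'))) /=.
have -> : \sum_(X : {set T} | #|X| == k) \sum_(x in X) 
    \sum_(x' | x' \notin X) (\prod_(z in X) y z) * (y x - y x') =
   (#|T| - k)%:R * U - k%:R * V.
  rewrite !mulr_sumr -sumrB; apply: eq_bigr => X /eqP Xk.
  set P := \prod_(z in X) y z; set c := \sum_(x in ~: X) y x.
  have cE : \sum_(x' | x' \notin X) y x' = c by apply: eq_bigl => x; rewrite inE.
  have XC : #|[pred x | x \notin X]| = (#|T| - k)%N.
    by rewrite -Xk -(cardC (mem X)) addKn; apply: eq_card.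
  transitivity (\sum_(x in X) (P * (#|T| - k)%:R * y x - P * c)).
    apply: eq_bigr => x _; rewrite -mulr_sumr sumrB cE sumr_const.
    by rewrite -[y x *+ _]mulr_natl XC mulrBr mulrA.
  by rewrite sumrB sumr_const Xk -mulr_sumr -mulr_natl; ring.
rewrite -mulrA UV natrB // -/V; lra.
Qed.

(* Replaces independence in sampling without replacement: the moment generating
   function of a sum over a random k-subset is the k-th elementary symmetric
   mean of the exponentials. *)
Lemma maclaurin k : (k <= #|T|)%N ->
  esym k <= 'C(#|T|, k)%:R * (#|T|%:R^-1 * \sum_x y x) ^+ k.
Proof.
elim: k => [|k IHk] kT.
  rewrite bin0 expr0 mulr1 /esym (big_pred1 set0) ?big_set0 // => X.
  by rewrite cards_eq0.
have T0 : 0 < #|T|%:R :> R by rewrite ltr0n (leq_ltn_trans _ kT).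
have k0 : 0 < k.+1%:R :> R by rewrite ltr0n.
rewrite -(ler_pM2l k0) -(ler_pM2l T0).
apply: le_trans (esym_step (ltnW kT)) _.
have S0 : 0 <= \sum_x y x by apply: sumr_ge0.
apply: le_trans (ler_wpM2l _ (IHk (ltnW kT))) _; first by rewrite mulr_ge0 ?ler0n.
rewrite le_eqVlt; apply/orP; left; apply/eqP.
rewrite [k.+1%:R * _]mulrA -natrM mul_bin_left natrM exprS.
by rewrite /=; field; rewrite gt_eqF.
Qed.

End ElementarySymmetric.

(** The deviation is measured relative to the bound M; with M = 2 (1 - p_0) this makes the sampling
    error proportional to 1 - p_0. *)
Lemma sampling_concentration (R : realType) (T : finType) (g : T -> R) (M s : R) K :
  (0 < K <= #|T|)%N -> (forall x, `|g x| <= M) -> 0 <= s <= 4 ->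
  probability (@uniform R _ [set X : {set T} | #|X| == K])
    (fun X => ~ (`|K%:R^-1 * \sum_(x in X) g x - #|T|%:R^-1 * \sum_x g x| <= s * M))
    <= 2 * expR (- (s ^+ 2 * K%:R / 32)).
Proof.
move=> /andP[K_gt0 KT] gM s04; have K0 : 0 < K%:R :> R by rewrite ltr0n.
have T_gt0 : (0 < #|T|)%N by apply: leq_trans KT.
have T0 : 0 < #|T|%:R :> R by rewrite ltr0n.
have SE : expectation (@uniform R _ [set X : {set T} | #|X| == K]).
  by apply: expectation_uniform; rewrite cardsE -cardsE card_draws bin_gt0.
have TE : expectation (@uniform R _ [set: T]).
  by apply: expectation_uniform; rewrite cardsT.
have M0 : 0 <= M.
  by have [x _] := card_gt0P T_gt0; apply: le_trans (gM x).
(* For M = 0 the function g vanishes and the bad event is empty; otherwise g is rescaled by M. *)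
have [M00|MN0] := eqVneq M 0.
  have -> : probability (@uniform R _ [set X : {set T} | #|X| == K])
    (fun X => ~ (`|K%:R^-1 * \sum_(x in X) g x - #|T|%:R^-1 * \sum_x g x| <= s * M)) = 0.
    rewrite -[RHS](expectation_cst 0 SE); congr uniform; apply/funext => X.
    have g0 x : g x = 0 by apply/eqP; rewrite -normr_le0 -M00.
    rewrite asboolF // => /negP; rewrite !big1 ?mulr0 ?subrr ?normr0 //.
    by rewrite mulr_ge0 //; case/andP: s04.
  by rewrite mulr_ge0 ?expR_ge0.
have {M0 MN0} M0 : 0 < M by rewrite lt_def MN0.
pose h x := g x / M; pose mu := uniform [set: T] h.
have h1 x : `|h x| <= 1 by rewrite normf_div (gtr0_norm M0) ler_pdivrMr // mul1r.
have muE : M * mu = #|T|%:R^-1 * \sum_x g x.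
  rewrite /mu /uniform cardsT (eq_bigl predT) => [|x]; last by rewrite inE.
  by rewrite -mulr_suml; field; rewrite !gt_eqF.
apply: (@le_trans _ _ (probability (@uniform R _ [set X : {set T} | #|X| == K])
    (fun X => ~ (`|\sum_(x in X) (h x - mu)| <= s * K%:R)))).
  rewrite le_eqVlt; apply/orP; left; apply/eqP.
  rewrite /probability /uniform; congr (_ * _); apply: eq_bigr => X.
  rewrite inE => /eqP XK; congr (asbool (~ is_true _))%:R.
  rewrite sumrB sumr_const XK -mulr_suml -muE -[mu *+ _]mulr_natl.
  have -> : K%:R^-1 * \sum_(x in X) g x - M * mu =
      ((\sum_(x in X) g x) / M - K%:R * mu) * (M / K%:R).
    by field; rewrite !gt_eqF.
  rewrite normrM (gtr0_norm (divr_gt0 M0 K0)) -ler_pdivlMr ?divr_gt0 //.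
  by congr (_ <= _); field; rewrite !gt_eqF.
apply: chernoff => // l l14.
(* The exponential of a sum over X is a product over X; [maclaurin] bounds the mean of these
   products by the K-th power of the mean for a single draw. *)
rewrite /uniform; under eq_bigr => X _ do rewrite mulr_sumr expR_sum.
have C0 : 0 < 'C(#|T|, K)%:R :> R by rewrite ltr0n bin_gt0.
rewrite card_draws mulrC ler_pdivrMr // mulrC (eq_bigl _ _ (fun X => in_set _ _)).
apply: le_trans (maclaurin _ KT) _; first by move=> x; apply: expR_ge0.
rewrite ler_pM2l // expRM_natr; apply: lerXn2r.
- by rewrite nnegrE mulr_ge0 ?invr_ge0 ?ler0n ?sumr_ge0 // => x _; apply: expR_ge0.
- by rewrite nnegrE expR_ge0.
apply: le_trans (centered_mgf_le TE h1 l14).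
rewrite -/mu /uniform cardsT le_eqVlt; apply/orP; left; apply/eqP.
by congr (_ * _); apply: eq_bigl => x; rewrite inE.
Qed.

(** * Pauli matrices *)

Section SignCharacters.

Lemma signF2D (R : pzRingType) (u v : 'F_2) :
  (-1) ^+ (u + v)%R = (-1) ^+ u * (-1) ^+ v :> R.
Proof. by rewrite -exprD -[RHS]signr_odd /= -[LHS]signr_odd odd_mod. Qed.

(** Translation by u permutes V and reverses the sign of the sum. *)
Lemma character_sum0 (R : numDomainType) (V : finZmodType) (chi : V -> R) u :
  (forall v w, chi (v + w) = chi v * chi w) -> chi u = -1 -> \sum_v chi v = 0.
Proof.
move=> chiD chiu.
have h : \sum_v chi v = - \sum_v chi v.
  rewrite {1}(reindex_inj (addrI u)) /= -mulN1r mulr_sumr.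
  by apply: eq_bigr => v _; rewrite chiD chiu.
have : 2 * \sum_v chi v = 0 by rewrite mulr_natl mulr2n {1}h addNr.
by move/eqP; rewrite mulf_eq0 pnatr_eq0 => /eqP.
Qed.

Definition dotF2 m (v w : 'rV['F_2]_m) : 'F_2 := \sum_i v 0 i * w 0 i.

Lemma dotF2Dl m (u v w : 'rV['F_2]_m) : dotF2 (u + v) w = dotF2 u w + dotF2 v w.
Proof. by rewrite -big_split; apply: eq_bigr => i _; rewrite mxE mulrDl. Qed.

Lemma dotF2Dr m (u v w : 'rV['F_2]_m) : dotF2 w (u + v) = dotF2 w u + dotF2 w v.
Proof. by rewrite -big_split; apply: eq_bigr => i _; rewrite mxE mulrDr. Qed.

Lemma F2_neq0 (u : 'F_2) : u != 0 -> u = 1.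
Proof. by case: u => [[|[|//]] ?] //= _; apply: val_inj. Qed.

Lemma addF2_mx m k (v : 'M['F_2]_(m, k)) : v + v = 0.
Proof.
by apply/matrixP => i j; rewrite !mxE; case: (v i j) => [[|[|//]] ?]; apply: val_inj.
Qed.

Lemma addF2_eq0 m k (u v : 'M['F_2]_(m, k)) : (u + v == 0) = (u == v).
Proof.
have vN : v = - v by apply/eqP; rewrite -addr_eq0 addF2_mx.
by rewrite [in LHS]vN subr_eq0.
Qed.

Lemma dotF2_character_sum (R : numDomainType) m (w : 'rV['F_2]_m) :
  \sum_v (-1) ^+ dotF2 v w = (2 ^ m * (w == 0))%:R :> R.
Proof.
have [->|/rV0Pn [i wi]] := eqVneq w 0.
  rewrite muln1 (eq_bigr (fun=> 1)) => [|v _].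
    by rewrite sumr_const card_mx mul1n card_Fp.
  by rewrite /dotF2 big1 ?expr0 // => i _; rewrite mxE mulr0.
rewrite muln0; apply: (@character_sum0 _ _ _ (delta_mx 0 i)) => [u v|].
  by rewrite dotF2Dl signF2D.
have -> : dotF2 (delta_mx 0 i) w = w 0 i.
  rewrite /dotF2 (bigD1 i) //= big1 => [|j ji]; last by rewrite mxE (negPf ji) mul0r.
  by rewrite mxE !eqxx mul1r addr0.
by rewrite (F2_neq0 wi) expr1.
Qed.

Lemma sympE n (a b : pauli n) :
  symp a b = dotF2 (xpart a) (zpart b) + dotF2 (zpart a) (xpart b).
Proof. by rewrite /symp big_split. Qed.

(** Swapping the halves of b turns the symplectic form into a dot product, from which bilinearity
    and the character sums are inherited. *)
Lemma symp_dotF2 n (a b : pauli n) : symp a b = dotF2 a (row_mx (zpart b) (xpart b)).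
Proof.
rewrite sympE /dotF2 big_split_ord /=; congr (_ + _); apply: eq_bigr => i _.
  by rewrite row_mxEl mxE.
by rewrite row_mxEr mxE.
Qed.

Lemma dotF2C m (v w : 'rV['F_2]_m) : dotF2 v w = dotF2 w v.
Proof. by apply: eq_bigr => i _; rewrite mulrC. Qed.

Lemma symp_signC (R : pzRingType) n (a b : pauli n) : symp_sign R a b = symp_sign R b a.
Proof. by rewrite /symp_sign !sympE addrC !(dotF2C (xpart b)) !(dotF2C (zpart b)). Qed.

Lemma symp_signDl (R : pzRingType) n (a b c : pauli n) :
  symp_sign R (a + b) c = symp_sign R a c * symp_sign R b c.
Proof. by rewrite /symp_sign !symp_dotF2 dotF2Dl signF2D. Qed.

Lemma symp_signDr (R : pzRingType) n (a b c : pauli n) :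
  symp_sign R a (b + c) = symp_sign R a b * symp_sign R a c.
Proof. by rewrite symp_signC symp_signDl !(symp_signC R a). Qed.

Lemma symp_signK (R : pzRingType) n (a b : pauli n) :
  symp_sign R a b * symp_sign R a b = 1.
Proof. by rewrite /symp_sign -expr2 sqrr_sign. Qed.

Lemma symp_sign_sum (R : numDomainType) n (b : pauli n) :
  \sum_(a : pauli n) symp_sign R a b = (4 ^ n * (b == 0))%:R.
Proof.
under eq_bigr do rewrite /symp_sign symp_dotF2.
have e : (2 ^ (n + n) = 4 ^ n)%N by rewrite addnn -muln2 mulnC expnM.
rewrite dotF2_character_sum e; congr (_ * (nat_of_bool _))%:R.
rewrite -row_mx0; apply/eqP/eqP => [/eq_row_mx [bz bx]|->].
  by rewrite -[b]hsubmxK -/(xpart b) -/(zpart b) bz bx row_mx0.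
by rewrite /zpart /xpart row_mxKl row_mxKr.
Qed.

Lemma card_pauli n : #|{: pauli n}| = (4 ^ n)%N.
Proof. by rewrite card_mx mul1n card_Fp // addnn -muln2 mulnC expnM. Qed.

End SignCharacters.

Section PauliMatrices.
Local Open Scope sesquilinear_scope.
Variables (R : realType) (n : nat).
Local Notation C := R[i].
Local Notation d := (qdim n).

(** Over F_2 the basis states become vectors, on which X[v] acts as translation by v and Z[v] as the
    character of v. *)
Definition bits (s : 'I_d) : 'rV['F_2]_n := \row_i (bitstring s i : 'F_2).

Definition of_bits (v : 'rV['F_2]_n) : 'I_d := enum_rank [ffun i => v 0 i : 'I_2].

Lemma bitsK : cancel bits of_bits.
Proof.
move=> s; apply: enum_val_inj; rewrite enum_rankK; apply/ffunP => i.
by rewrite ffunE mxE.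
Qed.

Lemma of_bitsK : cancel of_bits bits.
Proof.
by move=> v; apply/rowP => i; rewrite mxE /bitstring enum_rankK ffunE.
Qed.

Lemma qdimE : d = (2 ^ n)%N.
Proof. by rewrite /qdim card_ffun !card_ord. Qed.

Lemma prod_eq_nat m (P : 'I_m -> bool) :
  \prod_i (P i)%:R = [forall i, P i]%:R :> C.
Proof.
have [/forallP h|/forallPn[i Pi]] := boolP [forall i, P i].
  by rewrite big1 // => i _; rewrite h.
by rewrite (bigD1 i) //= (negPf Pi) mul0r.
Qed.

Lemma tensor_sigma_x v s t :
  tensor_power (sigma_x R) v s t = (bits s == bits t + v)%:R.
Proof.
rewrite mxE.
transitivity (\prod_i ((bits s 0 i == bits t 0 i + v 0 i)%:R : C)).
  apply: eq_bigr => i _; rewrite !mxE.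
  move: (bitstring s i) (bitstring t i) (v 0 i) => -[[|[|//]] ?] [[|[|//]] ?] [[|[|//]] ?] /=;
    by rewrite /= ?expr0 ?expr1 ?mxE.
rewrite prod_eq_nat; congr (nat_of_bool _)%:R; apply/forallP/eqP => [h|-> i].
  by apply/rowP => i; rewrite [RHS]mxE; apply/eqP.
by rewrite mxE.
Qed.

Lemma tensor_sigma_z v s t :
  tensor_power (sigma_z R) v s t = (s == t)%:R * (-1) ^+ dotF2 v (bits t).
Proof.
rewrite mxE.
transitivity (\prod_i (((bits s 0 i == bits t 0 i)%:R : C) * (-1) ^+ (v 0 i * bits t 0 i)%R)).
  apply: eq_bigr => i _; rewrite !mxE.
  move: (bitstring s i) (bitstring t i) (v 0 i) => -[[|[|//]] ?] [[|[|//]] ?] [[|[|//]] ?] /=;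
    by rewrite /= ?expr0 ?expr1 ?mxE /= ?mul1r ?mul0r.
rewrite big_split /= prod_eq_nat; congr (_ * _).
  congr (nat_of_bool _)%:R; apply/forallP/eqP => [h|-> //].
  by apply: (can_inj bitsK); apply/rowP => i; apply/eqP.
rewrite /dotF2 (big_morph (fun u : 'F_2 => (-1) ^+ u : C) (id1 := 1) (op1 := *%R)) //.
exact: signF2D.
Qed.

Definition pauli_phase (a : pauli n) : C :=
  'i ^+ (\sum_(i < n) (xpart a 0%R i : nat) * (zpart a 0%R i : nat))%N.

Lemma pauli_mxE (a : pauli n) s t :
  pauli_mx R a s t = pauli_phase a *
    ((bits s == bits t + xpart a)%:R * (-1) ^+ dotF2 (zpart a) (bits t)).
Proof.
rewrite mxE; congr (_ * _); rewrite mxE (bigD1 t) //= big1 => [|u ut].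
  by rewrite tensor_sigma_x tensor_sigma_z eqxx mul1r addr0.
by rewrite tensor_sigma_z (negPf ut) mul0r mulr0.
Qed.

Lemma pauli_phase_conj (a : pauli n) : pauli_phase a * (pauli_phase a)^* = 1.
Proof. by rewrite -normCK normrX normCi expr1n expr1n. Qed.


(** Conjugation turns i into -i, which costs -1 to the integer exponent of the phase; only the
    parity matters, and this is the dot product modulo 2. The resulting sign is the one that makes
    P_a Hermitian. *)
Lemma pauli_phase_sign (a : pauli n) :
  (pauli_phase a)^* = pauli_phase a * (-1) ^+ dotF2 (zpart a) (xpart a).
Proof.
rewrite /pauli_phase rmorphXn /= conjCi [LHS]exprNn [LHS]mulrC; congr (_ * _).
rewrite /dotF2 (big_morph (fun u : 'F_2 => (-1) ^+ u : C) (id1 := 1) (op1 := *%R)) //; last first.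
  exact: signF2D.
rewrite -[in LHS]prodrXr; apply: eq_bigr => i _.
by move: (xpart a 0 i) (zpart a 0 i) => -[[|[|//]] ?] [[|[|//]] ?].
Qed.

Lemma pauli_mx_herm (a : pauli n) : (pauli_mx R a)^t* = pauli_mx R a.
Proof.
apply/matrixP => s t; rewrite 2!mxE !pauli_mxE !rmorphM /= pauli_phase_sign.
rewrite rmorph_nat rmorph_sign.
have [ts|ts] := eqVneq (bits t) (bits s + xpart a).
  rewrite ts -addrA addF2_mx addr0 eqxx !mul1r dotF2Dr signF2D -mulrA.
  by congr (_ * _); rewrite mulrC.
case: eqP => [st|_]; last by rewrite !(mul0r, mulr0).
by case/eqP: ts; rewrite st -addrA addF2_mx addr0.
Qed.

Lemma pauli_mxM (a b : pauli n) s u : (pauli_mx R a *m pauli_mx R b) s u =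
  pauli_phase a * pauli_phase b * (bits s == bits u + xpart a + xpart b)%:R
   * ((-1) ^+ dotF2 (zpart a) (bits u) * (-1) ^+ dotF2 (zpart b) (bits u))
   * (-1) ^+ dotF2 (zpart a) (xpart b).
Proof.
rewrite mxE (bigD1 (of_bits (bits u + xpart b))) //= big1 => [|t tu].
  rewrite !pauli_mxE of_bitsK eqxx dotF2Dr signF2D addr0 addrAC mul1r.
  move: (pauli_phase a) (pauli_phase b) (_ == _)%:R ((-1) ^+ dotF2 (zpart a) (bits u))
    ((-1) ^+ dotF2 (zpart b) (bits u)) ((-1) ^+ dotF2 (zpart a) (xpart b)) => *; ring.
rewrite [in X in _ * X]pauli_mxE; case: eqP => [tE|_]; last by rewrite !(mul0r, mulr0).
by rewrite -tE bitsK eqxx in tu.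
Qed.

Lemma pauli_mxC (a b : pauli n) :
  pauli_mx R a *m pauli_mx R b = symp_sign C a b *: (pauli_mx R b *m pauli_mx R a).
Proof.
apply/matrixP => s u; rewrite [RHS]mxE (pauli_mxM a b) (pauli_mxM b a) /symp_sign sympE signF2D.
rewrite [bits u + xpart a + _]addrAC (dotF2C (xpart a)) (dotF2C (zpart a) (xpart b)).
set e := (-1) ^+ dotF2 (zpart b) (xpart a).
have ee : e * e = 1 by rewrite -expr2 sqrr_sign.
move: e ee (pauli_phase a) (pauli_phase b) (_ == _)%:R => e ee p q N.
move: ((-1) ^+ dotF2 (zpart a) (bits u)) ((-1) ^+ dotF2 (zpart b) (bits u)) => A B.
move: ((-1) ^+ dotF2 _ _) => E.
have -> : e * E * (q * p * N * (B * A) * e) = e * e * (p * q * N * (A * B) * E) by ring.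
by rewrite ee mul1r.
Qed.

Lemma pauli_mxK (a : pauli n) : pauli_mx R a *m pauli_mx R a = 1%:M.
Proof.
apply/matrixP => s u; rewrite pauli_mxM -addrA addF2_mx addr0 mxE.
rewrite (inj_eq (can_inj bitsK)); have := pauli_phase_conj a; rewrite pauli_phase_sign.
have : ((-1) ^+ dotF2 (zpart a) (bits u) : C) ^+ 2 = 1 by rewrite sqrr_sign.
move: (pauli_phase a) ((-1) ^+ dotF2 (zpart a) (xpart a)) => p E.
move: ((-1) ^+ _) (s == u)%:R => A N AA pE.
have -> : p * p * N * (A * A) * E = p * (p * E) * A ^+ 2 * N by ring.
by rewrite AA pE !mul1r.
Qed.

Lemma pauli_gate_pauli (a b : pauli n) :
  pauli_gate a (pauli_mx R b) = symp_sign C a b *: pauli_mx R b.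
Proof.
by rewrite /pauli_gate pauli_mx_herm pauli_mxC -scalemxAl -mulmxA pauli_mxK mulmx1.
Qed.

(** Completeness of the Pauli matrices, read entrywise. The sum over z-parts forces t = t'; then
    only the x-part s - t can contribute, and only if s = s'. *)
Lemma pauli_complete s t s' t' :
  \sum_(a : pauli n) (pauli_mx R a s t)^* * pauli_mx R a s' t'
   = (d * ((s == s') && (t == t')))%:R.
Proof.
transitivity (\sum_(a : pauli n) ((bits s == bits t + xpart a)%:R *
   (bits s' == bits t' + xpart a)%:R * (-1) ^+ dotF2 (zpart a) (bits t + bits t') : C)).
  apply: eq_bigr => a _; rewrite !pauli_mxE !rmorphM /= rmorph_nat rmorph_sign.
  rewrite dotF2Dr signF2D; have := pauli_phase_conj a.
  move: (pauli_phase a) ((pauli_phase a)^* ) ((-1) ^+ _) ((-1) ^+ _) => p p' B A pp.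
  move: (_ == _)%:R (_ == _)%:R => N M.
  have -> : p' * (M * A) * (p * (N * B)) = p * p' * (M * N * (A * B)) by ring.
  by rewrite pp mul1r.
transitivity (\sum_(x : 'rV['F_2]_n) \sum_(z : 'rV['F_2]_n)
   ((bits s == bits t + x)%:R *
   (bits s' == bits t' + x)%:R * (-1) ^+ dotF2 z (bits t + bits t') : C)).
  rewrite pair_big /= (reindex (fun p : 'rV['F_2]_n * 'rV['F_2]_n => row_mx p.1 p.2)) /=.
    by apply: eq_bigr => -[x z] _; rewrite /xpart /zpart row_mxKl row_mxKr.
  exists (fun a => (lsubmx a, rsubmx a)) => [[x z] _ | a _] /=.
    by rewrite row_mxKl row_mxKr.
  exact: hsubmxK.
under eq_bigr => x _ do rewrite -mulr_sumr dotF2_character_sum addF2_eq0 (inj_eq (can_inj bitsK)).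
rewrite -mulr_suml -[(2 ^ n)%N]qdimE; have [->|tt'] := eqVneq t t'; last by rewrite andbF !muln0 mulr0.
rewrite andbT muln1 mulnC natrM; congr (_ * _).
rewrite (bigD1 (bits s - bits t')) //= big1 ?addr0 => [|x xE].
  by rewrite addrC subrK eqxx mul1r (inj_eq (can_inj bitsK)) eq_sym.
case: eqP => [e|_]; last by rewrite mul0r.
by case/eqP: xE; rewrite e addrC addKr.
Qed.

Lemma hsE (A B : operator R n) : hs A B = \sum_s \sum_t (A s t)^* * B s t.
Proof.
rewrite /hs exchange_big; apply: eq_bigr => t _; rewrite mxE.
by apply: eq_bigr => s _; rewrite 2!mxE.
Qed.

Lemma d_gt0 : 0 < d%:R :> C.
Proof. by rewrite ltr0n qdimE expn_gt0. Qed.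

Lemma sqrtd_inv2 : (sqrtC (d%:R : C))^-1 * (sqrtC d%:R)^-1 = d%:R^-1.
Proof. by rewrite -invfM -expr2 sqrtCK. Qed.

Lemma sqrtd_inv_conj : ((sqrtC (d%:R : C))^-1)^* = (sqrtC d%:R)^-1.
Proof. by apply/CrealP; rewrite ger0_real // invr_ge0 sqrtC_ge0 ler0n. Qed.

Lemma ket_complete s t s' t' :
  \sum_(a : pauli n) (ket R a s t)^* * ket R a s' t' = ((s == s') && (t == t'))%:R.
Proof.
transitivity (d%:R^-1 * \sum_(a : pauli n) (pauli_mx R a s t)^* * pauli_mx R a s' t').
  rewrite mulr_sumr; apply: eq_bigr => a _.
  rewrite [ket R a s t]mxE [ket R a s' t']mxE rmorphM /= sqrtd_inv_conj -sqrtd_inv2.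
  by move: (pauli_mx R a s' t') (_^-1) ((pauli_mx R a s t)^* ) => *; ring.
by rewrite pauli_complete natrM mulrA mulVf ?mul1r // gt_eqF // d_gt0.
Qed.

Lemma ket_expansion (M : operator R n) : M = \sum_(a : pauli n) hs (ket R a) M *: ket R a.
Proof.
apply/matrixP => s' t'; rewrite summxE.
under eq_bigr => a _ do rewrite mxE hsE mulr_suml.
rewrite exchange_big /=.
transitivity (\sum_s \sum_t M s t * ((s == s') && (t == t'))%:R : C).
  rewrite (bigD1 s') //= [X in _ + X]big1 ?addr0 => [|s ss']; last first.
    by rewrite big1 // => t _; rewrite (negPf ss') mulr0.
  rewrite (bigD1 t') //= [X in _ + X]big1 ?addr0 => [|t tt']; last first.
    by rewrite (negPf tt') andbF mulr0.
  by rewrite !eqxx mulr1.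
apply: eq_bigr => s _.
under [RHS]eq_bigr => a _ do rewrite mulr_suml.
rewrite exchange_big /=; apply: eq_bigr => t _.
by rewrite -ket_complete mulr_sumr; apply: eq_bigr => a _; ring.
Qed.

Lemma ket_herm (a : pauli n) : (ket R a)^t* = ket R a.
Proof.
by rewrite /ket linearZ map_mxZ /= pauli_mx_herm sqrtd_inv_conj.
Qed.

Lemma pauli_gate_is_linear (a : pauli n) : linear (pauli_gate (R := R) a).
Proof.
by move=> c A B; rewrite /pauli_gate mulmxDr mulmxDl -scalemxAr -scalemxAl.
Qed.

HB.instance Definition _ (a : pauli n) :=
  GRing.isLinear.Build C (operator R n) (operator R n) _ (pauli_gate a)
    (pauli_gate_is_linear a).

Lemma pauli_gate_ket (a b : pauli n) :
  pauli_gate a (ket R b) = symp_sign C a b *: ket R b.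
Proof. by rewrite linearZ /= pauli_gate_pauli scalerA mulrC -scalerA. Qed.

(** After expanding M, the coefficient of P_b is multiplied by a character sum at x + b, which in
    characteristic 2 survives only for b = x. Signed averaging over the gates is therefore the
    projection onto |x). *)
Lemma pauli_twirl (x : pauli n) (M : operator R n) :
  \sum_a symp_sign C x a *: pauli_gate a M = (4 ^ n)%:R *: (hs (ket R x) M *: ket R x).
Proof.
transitivity (\sum_(b : pauli n) (\sum_(a : pauli n) symp_sign C a (x + b)) *:
   (hs (ket R b) M *: ket R b)).
  under [RHS]eq_bigr => b _ do rewrite scaler_suml.
  rewrite exchange_big /=; apply: eq_bigr => a _.
  rewrite {1}[M]ket_expansion linear_sum scaler_sumr; apply: eq_bigr => b _.
  rewrite linearZ /= pauli_gate_ket symp_signDr (symp_signC _ x a).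
  by move: (ket R b) (hs _ M) => k h; rewrite !scalerA mulrAC.
rewrite (bigD1 x) //= [X in _ + X]big1 ?addr0 => [|b bx].
  congr (_ *: _); apply: etrans (symp_sign_sum _ _) _.
  by rewrite addF2_mx eqxx muln1.
rewrite [X in X *: _](_ : _ = 0) ?scale0r //; apply: etrans (symp_sign_sum _ _) _.
by rewrite addF2_eq0 eq_sym (negPf bx) muln0.
Qed.

End PauliMatrices.

(** * Positive semidefinite matrices *)

Section PositiveSemidefinite.
Local Open Scope sesquilinear_scope.
Variable R : realType.
Local Notation C := R[i].

Lemma tr_conj_mul m k l (A : 'M[C]_(m, k)) (B : 'M[C]_(k, l)) :
  (A *m B)^t* = B^t* *m A^t*.
Proof. by rewrite trmx_mul map_mxM. Qed.

Lemma psd_gram m k (B : 'M[C]_(m, k)) : psd (B *m B^t*).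
Proof.
move=> v; rewrite mulmxA -mulmxA.
have -> : B^t* *m v = (v^t* *m B)^t* by rewrite tr_conj_mul trmxCK.
by rewrite mxE sumr_ge0 // => i _; rewrite 2![in X in _ * X]mxE -normCK exprn_ge0.
Qed.

Lemma psd_congr m k (A : 'M[C]_m) (B : 'M[C]_(k, m)) :
  psd A -> psd (B *m A *m B^t*).
Proof.
move=> Apsd v; have := Apsd (B^t* *m v).
by rewrite tr_conj_mul trmxCK !mulmxA.
Qed.

Lemma psd_diag_ge0 m (A : 'M[C]_m) i : psd A -> 0 <= A i i.
Proof.
move=> Apsd; have := Apsd (delta_mx i 0).
by rewrite trmx_delta map_delta_mx -rowE -colE !mxE.
Qed.

(* Polarization at the vectors e_i + e_j and e_i + i e_j. *)
Lemma psd_herm m (A : 'M[C]_m) : psd A -> A^t* = A.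
Proof.
move=> Apsd; pose q (u v : 'cV[C]_m) := (u^t* *m A *m v) 0 0.
have qr v : (q v v)^* = q v v by apply/CrealP; apply: ger0_real; exact: Apsd.
have qD u v c : q (u + c *: v) (u + c *: v) =
    q u u + c^* * c * q v v + (c * q u v + c^* * q v u).
  rewrite /q; set w := map_mx _ (trmx (u + c *: v)).
  have -> : w = u^t* + c^* *: v^t*.
    by apply/matrixP => i j; rewrite !mxE rmorphD rmorphM.
  rewrite !mulmxDl !mulmxDr.
  rewrite -!scalemxAl -!scalemxAr.
  move: (u^t* *m A *m u) (u^t* *m A *m v) (v^t* *m A *m u) (v^t* *m A *m v) => a b c' e.
  by rewrite !mxE; move: (a 0 0) (b 0 0) (c' 0 0) (e 0 0) c^* => *; ring.
have cross u v c : (c * q u v + c^* * q v u)^* = c * q u v + c^* * q v u.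
  have := qr (u + c *: v); rewrite qD rmorphD /= [in LHS]rmorphD /= qr.
  by rewrite rmorphM /= rmorphM /= conjCK qr mulrC [c * _]mulrC mulrC => /addrI.
apply/matrixP => i j; rewrite 2!mxE.
pose e k : 'cV[C]_m := delta_mx k 0.
have qe k l : q (e k) (e l) = A k l.
  by rewrite /q /e trmx_delta map_delta_mx -rowE -colE !mxE.
have h1 := cross (e j) (e i) 1; have h2 := cross (e j) (e i) 'i.
rewrite !qe conjC1 !mul1r rmorphD /= in h1.
rewrite !qe conjCi rmorphD !rmorphM rmorphN /= conjCi opprK in h2.
have h3 : - (A j i)^* + (A i j)^* = A j i - A i j.
  apply: (mulfI (neq0Ci C)); move: h2.
  by rewrite mulrDr mulrN mulrBr !mulNr.
have : 2 * (A j i)^* = 2 * A i j.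
  move: (A j i) (A i j) ((A j i)^* ) ((A i j)^* ) h1 h3 {h2} => z w x y h1 h3.
  have -> : 2 * x = (x + y) - (- x + y) by ring.
  by rewrite h1 h3; ring.
by move/mulfI; apply; rewrite pnatr_eq0.
Qed.

(** In an eigenbasis of A the trace is a sum of eigenvalues of A times diagonal entries of the
    rotated B. This makes Born probabilities nonnegative. *)
Lemma psd_tr_ge0 m (A B : 'M[C]_m) : psd A -> psd B -> 0 <= \tr (A *m B).
Proof.
move=> Apsd Bpsd; have /orthomx_spectralP : A \is normalmx.
  by apply/normalmxP; rewrite psd_herm.
set P := spectralmx A; set D := spectral_diag A => AE.
have Pu : P \is unitarymx by apply: spectral_unitarymx.
have PP : P *m P^t* = 1%:M by apply/unitarymxP.
rewrite invmx_unitary // in AE.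
have DE : diag_mx D = P *m A *m P^t*.
  by rewrite AE !mulmxA PP mul1mx -mulmxA PP mulmx1.
rewrite AE -!mulmxA mxtrace_mulC -mulmxA.
rewrite -mulmxA [P *m _]mulmxA; set Q := P *m B *m _.
have Qpsd : psd Q by apply: psd_congr.
rewrite /mxtrace sumr_ge0 // => i _; rewrite mul_diag_mx mxE mulr_ge0 ?psd_diag_ge0 //.
have -> : D 0 i = diag_mx D i i by rewrite mxE eqxx.
by rewrite DE; apply/psd_diag_ge0/psd_congr.
Qed.

End PositiveSemidefinite.

(** * Syndromes, Pauli eigenvalues and error rates *)

(** [repr] respects products of cosets only up to a factor in H; signs that are trivial on H do not
    see this factor. *)
Lemma repr_coset_mul (gT : finGroupType) (H : {group gT}) (s : gT) (b c : coset_of H) :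
  s \in 'N(H)%g -> c = (b * coset H s)%g ->
  exists2 h, h \in H & repr c = (h * (repr b * s))%g.
Proof.
move=> sN cb; have bN := repr_coset_norm b.
have cE : coset H (repr c) = coset H (repr b * s)%g.
  by rewrite (morphM (coset H)) //= !coset_reprK.
have /rcosetP [h hH ->] : repr c \in (H :* (repr b * s))%g.
  by apply/rcoset_kercosetP; rewrite ?repr_coset_norm ?groupM.
by exists h.
Qed.

Section Syndromes.
Variables (n : nat).

Lemma pauli_mulg (a b : pauli n) : (a * b)%g = a + b.
Proof. by []. Qed.

Lemma pauli_norm (H : {set pauli n}) (a : pauli n) : a \in 'N(H)%g.
Proof.
rewrite inE; apply/subsetP => b /imsetP[c cH ->].
suff -> : (c ^ a)%g = c by [].
by rewrite conjgE !pauli_mulg [c + a]addrC -pauli_mulg mulKg.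
Qed.

Lemma repr_coset_sign (R : pzRingType) (H : {group pauli n}) (x s : pauli n)
    (b c : coset_of H) :
  (forall h, h \in H -> symp x h = 0) -> c = (b * coset H s)%g ->
  symp_sign R x (repr c) = symp_sign R x (repr b) * symp_sign R x s.
Proof.
move=> xH cb; have [h hH ->] := repr_coset_mul (pauli_norm H s) cb.
by rewrite !pauli_mulg !symp_signDr {1}/symp_sign xH // expr0 mul1r.
Qed.

Lemma commutant_group_set (G : {group pauli n}) : group_set (commutant G).
Proof.
apply/group_setP; split=> [|a b].
  by rewrite inE; apply/forall_inP => g _; rewrite sympE /dotF2 !big1 ?addr0 // => i _;
     rewrite /xpart /zpart !mxE mul0r.
rewrite !inE => /forall_inP aG /forall_inP bG; apply/forall_inP => g gG.
by rewrite symp_dotF2 pauli_mulg dotF2Dl -!symp_dotF2 (eqP (aG g gG)) (eqP (bG g gG)) addr0.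
Qed.

Lemma syndrome_sign_mul (R : pzRingType) (G : {group pauli n}) (x s : pauli n)
    (b : syndrome G) : x \in G ->
  syndrome_sign R x (b * (coset (commutant G) s : syndrome G))%g
    = syndrome_sign R x b * symp_sign R x s.
Proof.
move=> xG; apply: (@repr_coset_sign R (Group (commutant_group_set G))) => // h.
rewrite inE => /forall_inP /(_ x xG) /eqP.
by rewrite !sympE addrC !(dotF2C (xpart h)) !(dotF2C (zpart h)).
Qed.

End Syndromes.

Section NoiseSuperoperators.
Local Open Scope sesquilinear_scope.
Variables (R : realType) (n : nat).
Local Notation C := R[i].
Local Notation d := (qdim n).

Lemma hs_is_scalar (A : operator R n) : scalar (hs A).
Proof. by move=> c B D; rewrite /hs mulmxDr -scalemxAr mxtraceD mxtraceZ. Qed.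

HB.instance Definition _ (A : operator R n) :=
  GRing.isLinear.Build C (operator R n) C _ (hs A) (hs_is_scalar A).

Lemma hsZl c (A B : operator R n) : hs (c *: A) B = c^* * hs A B.
Proof.
rewrite !hsE mulr_sumr; apply: eq_bigr => s _; rewrite mulr_sumr; apply: eq_bigr => t _.
by rewrite mxE rmorphM mulrA.
Qed.

Lemma conj_tr m (A : 'M[C]_m) : (\tr A)^* = \tr (A^t*).
Proof. by rewrite rmorph_sum; apply: eq_bigr => i _; rewrite 2!mxE. Qed.

Lemma hs_herm_real (A B : operator R n) : A^t* = A -> B^t* = B -> 
  hs A B = (complex.Re (hs A B))%:C%C.
Proof.
move=> Ah Bh; rewrite complex.RRe_real //; apply/CrealP.
by rewrite /hs Ah conj_tr tr_conj_mul Ah Bh mxtrace_mulC.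
Qed.

Lemma hs_psd_ge0 (A B : operator R n) : psd A -> psd B -> 0 <= complex.Re (hs A B).
Proof.
move=> Ap Bp; have := psd_tr_ge0 Ap Bp.
by rewrite -{1}(psd_herm Ap) -/(hs A B) lecE => /andP[_].
Qed.

Lemma hs_pauli_gate (a : pauli n) (A B : operator R n) :
  hs (pauli_gate a A) B = hs A ((pauli_mx R a)^t* *m B *m pauli_mx R a).
Proof.
rewrite /hs /pauli_gate !tr_conj_mul trmxCK -!mulmxA mxtrace_mulC.
by rewrite -!mulmxA.
Qed.

Lemma tr_pauli_gate (a : pauli n) (A : operator R n) : \tr (pauli_gate a A) = \tr A.
Proof.
by rewrite /pauli_gate mxtrace_mulC mulmxA pauli_mx_herm pauli_mxK mul1mx.
Qed.

(** A test vector of the block matrix is a family of k vectors, so complete positivity can be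
    applied through a scalar double sum. *)
Lemma psd_mxblockP k (B : 'I_k -> 'I_k -> operator R n) :
  psd (\mxblock_(i < k, j < k) B i j) <->
  forall v : 'I_k -> 'cV[C]_d, 0 <= \sum_i \sum_j ((v i)^t* *m B i j *m v j) 0 0.
Proof.
have E (v : 'I_k -> 'cV[C]_d) :
    ((\mxcol_i v i)^t* *m (\mxblock_(i < k, j < k) B i j) *m \mxcol_i v i) 0 0
    = \sum_i \sum_j ((v i)^t* *m B i j *m v j) 0 0.
  have -> : (\mxcol_i v i)^t* = \mxrow_i (v i)^t*.
    by apply/matrixP => i j; rewrite !mxE.
  rewrite mul_mxrow_mxblock mul_mxrow_mxcol summxE exchange_big.
  by apply: eq_bigr => i _; rewrite mulmx_suml summxE.
split=> [Bp v | Bp v]; first by rewrite -E; apply: Bp.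
by rewrite -(submxcolK v) E; apply: Bp.
Qed.

End NoiseSuperoperators.

Section Noise.
Local Open Scope sesquilinear_scope.
Variables (R : realType) (n : nat) (noise : gtm_noise R n).
Local Notation C := R[i].
Local Notation d := (qdim n).
Local Notation Lambda := (channel noise).
Local Notation f := (eigenvalue_of noise).

Lemma channel_psd A : psd A -> psd (Lambda A).
Proof.
move=> Ap v; have /psd_mxblockP /(_ (fun=> v)) : psd (\mxblock_(i < 1, j < 1) Lambda A).
  apply: (@channel_cp R n noise 1 (fun _ _ => A)); apply/psd_mxblockP => w.
  by apply: sumr_ge0 => i _; apply: sumr_ge0 => j _; rewrite (ord1 i) (ord1 j); apply: Ap.
by rewrite !big_ord1.
Qed.

Lemma noisy_gate_density a rho : density rho -> density (noisy_gate noise a rho).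
Proof.
move=> [rp r1]; split; first exact/psd_congr/channel_psd.
by rewrite tr_pauli_gate channel_tp.
Qed.

(* 2 (I + P_a) is the Gram matrix of I + P_a. *)
Lemma channel_pauli_herm a : (Lambda (pauli_mx R a))^t* = Lambda (pauli_mx R a).
Proof.
set P := pauli_mx R a; have Ih : (Lambda 1%:M)^t* = Lambda 1%:M.
  apply/psd_herm/channel_psd; have := psd_gram (1%:M : operator R n).
  by rewrite trmx1 map_mx1 mulmx1.
have := psd_herm (channel_psd (psd_gram (1%:M + P))).
have -> : (1%:M + P)^t* = 1%:M + P.
  by rewrite -[P in RHS]pauli_mx_herm; apply/matrixP => i j; rewrite !mxE rmorphD rmorph_nat eq_sym.
have -> : (1%:M + P) *m (1%:M + P) = (1%:M + 1%:M) + (P + P).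
  by rewrite mulmxDl !mulmxDr !mulmx1 mul1mx pauli_mxK [P + 1%:M]addrC addrACA.
rewrite !linearD /= => /matrixP e; apply/matrixP => i j.
have /matrixP/(_ i j) := Ih; have := e i j; rewrite !mxE !rmorphD /=.
move: (Lambda 1%:M i j) (Lambda P i j) ((Lambda 1%:M j i)^* ) ((Lambda P j i)^* ).
move=> x y z w; rewrite -!mulr2n => + xz; rewrite xz => /addrI /eqP.
by rewrite eqrMn2r // => /eqP.
Qed.

Lemma eigenvalueE a : hs (ket R a) (Lambda (ket R a)) = (f a)%:C%C.
Proof.
apply: hs_herm_real; first exact: ket_herm.
by rewrite /ket linearZ linearZ map_mxZ /= channel_pauli_herm sqrtd_inv_conj.
Qed.

Lemma real_complex_sign (a b : pauli n) : (symp_sign R a b)%:C%C = symp_sign C a b :> C.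
Proof. by rewrite rmorph_sign. Qed.

(* Positivity of the Choi matrix of the channel at the vector sum_i e_i (x) P_a e_i. *)
Lemma error_rate_ge0 a : 0 <= error_rate noise a.
Proof.
rewrite mulr_ge0 ?invr_ge0 ?exprn_ge0 ?ler0n // -ler0c rmorph_sum.
rewrite (eq_bigr (fun b => symp_sign C a b * hs (ket R b) (Lambda (ket R b)))) => [|b _];
  last by rewrite rmorphM eigenvalueE; congr (_ * _); apply: real_complex_sign.
(* The block matrix of all matrix units is the unnormalized maximally entangled projector; its
   quadratic form is |\sum_i v_i(i)|^2. *)
have : psd (\mxblock_(i < d, j < d) Lambda (delta_mx i j)).
  apply: (@channel_cp R n noise d); apply/psd_mxblockP => v.
  have E i j : ((v i)^t* *m delta_mx i j *m v j) 0 0 = (v i i 0)^* * v j j 0.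
    rewrite -(mul_delta_mx (0 : 'I_1)) mulmxA -mulmxA -rowE -colE mxE big_ord1.
    by rewrite !mxE.
  under eq_bigr => i _ do (under eq_bigr => j _ do rewrite E; rewrite -mulr_sumr).
  by rewrite -mulr_suml -rmorph_sum mulrC -normCK exprn_ge0.
move=> /psd_mxblockP /(_ (fun i => pauli_mx R a *m delta_mx i 0)).
congr (0 <= _).
transitivity (\sum_i \sum_j ((pauli_mx R a)^t* *m Lambda (delta_mx i j) *m pauli_mx R a) i j).
  apply: eq_bigr => i _; apply: eq_bigr => j _.
  by rewrite tr_conj_mul trmx_delta map_delta_mx !mulmxA -!mulmxA -rowE !mulmxA -colE !mxE.
(* Expanding the matrix units in the Pauli basis and then summing over i and j gives Hilbert-Schmidt
   products with |b); moving P_a to their left argument produces the sign of <a, b>. *)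
transitivity (\sum_i \sum_j \sum_b (ket R b i j)^* *
    ((pauli_mx R a)^t* *m Lambda (ket R b) *m pauli_mx R a) i j).
  apply: eq_bigr => i _; apply: eq_bigr => j _.
  rewrite {1}[delta_mx i j]ket_expansion linear_sum mulmx_sumr mulmx_suml summxE.
  apply: eq_bigr => b _.
  rewrite [Lambda _]linearZ; move: (pauli_mx R a) (Lambda (ket R b)) => P N /=.
  rewrite -scalemxAr -scalemxAl mxE; congr (_ * _).
  rewrite hsE (bigD1 i) //= [X in _ + X]big1 ?addr0 => [|s si]; last first.
    by rewrite big1 // => t _; rewrite [delta_mx _ _ _ _]mxE (negPf si) mulr0.
  rewrite (bigD1 j) //= [X in _ + X]big1 ?addr0 => [|t tj]; last first.
    by rewrite [delta_mx _ _ _ _]mxE (negPf tj) andbF mulr0.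
  by rewrite [delta_mx _ _ _ _]mxE !eqxx mulr1.
transitivity (\sum_i \sum_b \sum_j (ket R b i j)^* *
    ((pauli_mx R a)^t* *m Lambda (ket R b) *m pauli_mx R a) i j).
  by apply: eq_bigr => i _; apply: exchange_big.
rewrite exchange_big /=; apply: eq_bigr => b _; rewrite -hsE -hs_pauli_gate pauli_gate_ket.
by rewrite hsZl rmorph_sign.
Qed.

End Noise.

(** * The Walsh-Hadamard transform between eigenvalues and error rates *)

Section ErrorRates.
Variables (R : realType) (n : nat) (noise : gtm_noise R n).
Local Notation f := (eigenvalue_of noise).
Local Notation p := (error_rate noise).
Local Notation r := (infidelity_of noise).

Lemma pauli_add_eq0 (a b : pauli n) : (a + b == 0) = (a == b).
Proof. exact: addF2_eq0. Qed.

Lemma pow4_neq0 : (4 ^+ n : R) != 0.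
Proof. by rewrite expf_neq0 // pnatr_eq0. Qed.

Lemma eigenvalue_inversion x : f x = \sum_(a : pauli n) symp_sign R x a * p a.
Proof.
transitivity (4 ^- n * \sum_(b : pauli n) (\sum_(a : pauli n) symp_sign R a (x + b)) * f b).
  rewrite (bigD1 x) //= [X in _ + X]big1 ?addr0 => [|b bx].
    rewrite symp_sign_sum addF2_mx eqxx muln1 natrX mulrA mulVf ?mul1r //.
    exact: pow4_neq0.
  by rewrite symp_sign_sum pauli_add_eq0 eq_sym (negPf bx) muln0 mul0r.
under [RHS]eq_bigr => a _ do rewrite /error_rate mulrCA mulr_sumr.
rewrite -mulr_sumr exchange_big /=; congr (_ * _); apply: eq_bigr => b _.
rewrite mulr_suml; apply: eq_bigr => a _.
by rewrite symp_signDr mulrA (symp_signC _ x a).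
Qed.

Lemma error_rate_infidelity a :
  p a = (a == 0)%:R - (4 ^ n)%:R^-1 * \sum_(b : pauli n) symp_sign R a b * r b.
Proof.
rewrite natrX; have -> : \sum_(b : pauli n) symp_sign R a b * r b =
    \sum_(b : pauli n) symp_sign R b a - \sum_(b : pauli n) symp_sign R a b * f b.
  rewrite -sumrB; apply: eq_bigr => b _.
  by rewrite /infidelity_of mulrBr mulr1 (symp_signC _ b).
rewrite symp_sign_sum natrM natrX mulrBr mulrA mulVf ?pow4_neq0 // mul1r.
by rewrite opprB addrC subrK.
Qed.

Hypothesis f_le1 : forall a, f a <= 1.

Lemma symp_sign0 a : symp_sign R (0 : pauli n) a = 1.
Proof. by have := symp_signDl R 0 0 a; rewrite addr0 symp_signK. Qed.

Lemma sum_error_rate : \sum_(a : pauli n) p a = f 0.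
Proof.
rewrite eigenvalue_inversion; apply: eq_bigr => a _.
by rewrite symp_sign0 mul1r.
Qed.

Lemma infidelity_ge0 x : 0 <= r x.
Proof. by rewrite subr_ge0. Qed.

(** In the expansion of f_x over error rates the term a = 0 has sign +1 and every other one a sign
    at least -1; the p_a are nonnegative and sum to f_0 <= 1. *)
Lemma infidelity_le x : r x <= 2 * (1 - p 0).
Proof.
have s0 := sum_error_rate; have f0 := f_le1 0.
have fx : p 0 - \sum_(a | a != 0) p a <= f x.
  rewrite eigenvalue_inversion [leRHS](bigD1 (0 : pauli n)) //= -sumrN; apply: lerD.
    by rewrite symp_signC symp_sign0 mul1r.
  apply: ler_sum => a _; rewrite -mulN1r ler_wpM2r ?error_rate_ge0 //.
  by rewrite /symp_sign; case: (nat_of_ord _) => [|[|k]] //;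
    rewrite -signr_odd; case: odd; rewrite ?expr0 ?expr1; lra.
rewrite (bigD1 (0 : pauli n)) //= in s0.
rewrite /infidelity_of; move: (f x) (f 0) (p 0) (\sum_(a | _) _) s0 f0 fx => *; lra.
Qed.

Lemma error_prob_ge0 : 0 <= 1 - p 0.
Proof. by have := le_trans (infidelity_ge0 0) (infidelity_le 0); rewrite pmulr_rge0. Qed.

End ErrorRates.

(** * The expected sign returned by RunCB *)

Section RunCB.
Local Open Scope sesquilinear_scope.
Variables (R : realType) (n : nat) (noise : gtm_noise R n).
Local Notation C := R[i].
Local Notation Lambda := (channel noise).
Local Notation f := (eigenvalue_of noise).

(** Stated with a continuation g: measuring is an expectation only on density operators, so g is
    constrained only there, and noisy gates preserve densities. *)
Lemma expectation_random_gates B k rho s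
    (g : operator R n * pauli n -> random R B) :
  density rho -> (forall rho' s', density rho' -> expectation (g (rho', s'))) ->
  expectation (bind (random_gates noise k rho s) g).
Proof.
move=> + gE; elim: k rho s => [|k IHk] rho s rho_d; first exact: gE.
apply: (@expectation_bind _ _ _ (uniform [set: pauli n])
  (fun a => bind (random_gates noise k (noisy_gate noise a rho) (s + a)) g)).
  by apply: expectation_uniform; rewrite cardsT card_pauli expn_gt0.
by move=> a; apply/IHk/noisy_gate_density.
Qed.

Lemma complex_Re_sum (I : Type) (s : seq I) (F : I -> C) :
  complex.Re (\sum_(i <- s) F i) = \sum_(i <- s) complex.Re (F i).
Proof. exact: (raddf_sum (@complex.Re R : Rcomplex R -> R)). Qed.

Lemma complex_Re_scale (x : R) (z : C) : complex.Re (x%:C%C * z) = x * complex.Re z.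
Proof. by case: z => u v /=; rewrite mul0r subr0. Qed.

Lemma expectation_measure (G : {group pauli n}) rho :
  stabilizer_group G -> density rho -> expectation (@measure R n noise G rho).
Proof.
move=> /(meas_povm noise) [Ep E1] [rp r1]; split; rewrite /measure.
- by move=> g h; rewrite -big_split; apply: eq_bigr => b _; rewrite mulrDr.
- by move=> c g; rewrite mulr_sumr; apply: eq_bigr => b _; rewrite mulrCA.
- by move=> g g0; apply: sumr_ge0 => b _; rewrite mulr_ge0 // hs_psd_ge0.
- under eq_bigr do rewrite mulr1.
  rewrite -complex_Re_sum; have -> : \sum_(b : syndrome G) hs (meas noise b) rho = 1.
    rewrite -r1 -[in RHS](mul1mx rho) -E1 mulmx_suml raddf_sum.
    by apply: eq_bigr => b _; rewrite /hs psd_herm.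
  by [].
Qed.

Lemma expectation_run_cb (G : {group pauli n}) m :
  stabilizer_group G -> expectation (@run_cb R n noise G m).
Proof.
move=> Gs; apply: expectation_random_gates; first exact: prep_density.
move=> rho s rho_d; apply: expectation_bind; first exact: expectation_measure.
by move=> b; apply: expectation_ret.
Qed.

Lemma uniform_noisy_gate (x : pauli n) (l : operator R n -> C) rho (s : pauli n) :
  scalar l ->
  uniform [set: pauli n]
      (fun a => symp_sign R x (s + a) * complex.Re (l (noisy_gate noise a rho)))
    = symp_sign R x s * complex.Re (hs (ket R x) (Lambda rho) * l (ket R x)).
Proof.
move=> ll.
have lD A B : l (A + B) = l A + l B by have := ll 1 A B; rewrite scale1r mul1r.
have l0 : l 0 = 0 by have := ll (-1) 0 0; rewrite scaler0 addr0 mulN1r addNr.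
have lZ c A : l (c *: A) = c * l A by have := ll c A 0; rewrite l0 !addr0.
have lS (F : pauli n -> operator R n) : l (\sum_a F a) = \sum_a l (F a).
  exact: (big_morph l lD l0).
have := pauli_twirl x (Lambda rho); move/(congr1 l); rewrite lS 2!lZ.
under eq_bigr do rewrite lZ.
move=> e; rewrite /uniform (eq_bigl predT) => [|a]; last by rewrite inE.
rewrite cardsT card_pauli.
transitivity ((4 ^ n)%:R^-1 * (symp_sign R x s *
  complex.Re (\sum_(a : pauli n) symp_sign C x a * l (pauli_gate a (Lambda rho))))).
  congr (_ * _); rewrite complex_Re_sum mulr_sumr; apply: eq_bigr => a _.
  rewrite symp_signDr -mulrA; congr (_ * _).
  by rewrite -complex_Re_scale; congr (complex.Re (_ * _)); apply: real_complex_sign.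
rewrite e; have -> : (4 ^ n)%:R = ((4 ^ n)%:R : R)%:C%C by rewrite rmorph_nat.
rewrite complex_Re_scale mulrCA; congr (_ * _).
by rewrite mulrA mulVf ?mul1r // pnatr_eq0 expn_eq0.
Qed.

(** Inductively, the gates after the first act as f_x^k times the linear functional [l']; averaging
    over the first gate evaluates [l'] at |x), which yields one more factor f_x. Of the k + 1 noise
    steps the first acts on rho and is left to the SPAM parameter. *)
Lemma random_gates_sign (x : pauli n) (l : operator R n -> C) k rho s :
  scalar l ->
  random_gates noise k.+1 rho s
      (fun z => symp_sign R x z.2 * complex.Re (l z.1))
    = symp_sign R x s * (f x ^+ k * complex.Re (hs (ket R x) (Lambda rho) * l (ket R x))).
Proof.
move=> ll; elim: k rho s => [|k IHk] rho s.
  by rewrite mul1r -uniform_noisy_gate.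
pose l' A := hs (ket R x) (Lambda A) * l (ket R x).
have l'l : scalar l' by move=> c A B; rewrite /l' !linearP mulrDl mulrA.
transitivity (f x ^+ k * uniform [set: pauli n]
   (fun a => symp_sign R x (s + a) * complex.Re (l' (noisy_gate noise a rho)))).
  rewrite mulrCA /uniform mulr_sumr -[LHS]/(uniform _ _) /uniform; congr (_ * _).
  by apply: eq_bigr => a _; rewrite [LHS]IHk mulrCA.
rewrite uniform_noisy_gate // /l' eigenvalueE mulrCA; congr (_ * _).
by rewrite mulrCA complex_Re_scale mulrA exprSr.
Qed.

Lemma run_cb_sign (G : {group pauli n}) m x :
  stabilizer_group G -> x \in G ->
  @run_cb R n noise G m (fun z => syndrome_sign R x z) = spam noise G x * f x ^+ m.
Proof.
move=> Gs xG.
pose l A := \sum_(b : syndrome G) syndrome_sign C x b * hs (meas noise b) A.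
have ll : scalar l.
  move=> c A B; rewrite /l mulr_sumr -big_split; apply: eq_bigr => b _ /=.
  by rewrite linearP /= mulrDr mulrCA.
transitivity (random_gates noise m.+1 (prep noise G) 0
   (fun z => symp_sign R x z.2 * complex.Re (l z.1))).
  congr (random_gates noise m.+1 (prep noise G) 0 _); apply/funext => -[rho s].
  rewrite /bind /measure /ret /= complex_Re_sum mulr_sumr; apply: eq_bigr => b _.
  rewrite syndrome_sign_mul // mulrC -mulrA mulrCA; congr (_ * _).
  by rewrite -complex_Re_scale; congr (complex.Re (_ * _)); apply: real_complex_sign.
rewrite random_gates_sign // symp_signC symp_sign0 mul1r.
rewrite mulrC; congr (complex.Re _ * _).
rewrite /l mulr_sumr; apply: eq_bigr => b _; rewrite mulrC; congr (_ * _).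
Qed.

Lemma syndrome_sign_norm (G : {group pauli n}) x (z : syndrome G) :
  `|syndrome_sign R x z| <= 1.
Proof. by rewrite /syndrome_sign /symp_sign normrX normrN1 expr1n. Qed.

(** At m = 0 the SPAM parameter is itself the expectation of a sign. *)
Lemma spam_le1 (G : {group pauli n}) x :
  stabilizer_group G -> x \in G -> spam noise G x <= 1.
Proof.
move=> Gs xG; have := run_cb_sign 0 Gs xG; rewrite mulr1 => <-.
apply: le_trans (ler_norm _) _; apply: expectation_norm_le1.
  exact: expectation_run_cb.
exact: syndrome_sign_norm.
Qed.

End RunCB.

(** * Accuracy of Ratio *)

Section RatioStep.
Variable R : realType.
Implicit Types (f v w s A x : R) (m : nat).

Lemma bernoulli (x : R) m : -1 <= x -> 1 + m%:R * x <= (1 + x) ^+ m.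
Proof.
move=> x1; elim: m => [|m IHm]; first by rewrite mul0r addr0 expr0.
have x1' : 0 <= 1 + x by lra.
rewrite exprS -[m.+1]addn1 natrD.
apply: le_trans (ler_wpM2l x1' IHm).
have : 0 <= m%:R * x ^+ 2 by rewrite mulr_ge0 ?ler0n ?sqr_ge0.
nra.
Qed.

(** Through (1 - 2h/m)^m <= e^(-2h) <= 1/(1 + 2h), and (1 - h)(1 + 2h) >= 1 for 0 <= h <= 1/2. *)
Lemma expr_le_half_root (h : R) m : 0 <= h <= 1 / 2 -> (0 < m)%N ->
  (1 - 2 * h / m%:R) ^+ m <= 1 - h.
Proof.
move=> /andP[h0 h1] m_gt0; have m1 : 1 <= m%:R :> R by rewrite ler1n.
have m0 : 0 < m%:R :> R by rewrite ltr0n.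
have hm : 2 * h / m%:R <= 1 by rewrite ler_pdivrMr // mul1r; lra.
apply: (@le_trans _ _ (expR (- (2 * h)))).
  have -> : - (2 * h) = - (2 * h / m%:R) * m%:R by field; rewrite gt_eqF.
  rewrite expRM_natr; apply: lerXn2r; rewrite ?nnegrE ?expR_ge0 //; first by lra.
  exact: expR_ge1Dx.
rewrite expRN -[leRHS]invrK lef_pV2 ?posrE ?expR_gt0 ?invr_gt0 //; last by lra.
apply: le_trans (expR_ge1Dx _); rewrite -[leLHS]div1r ler_pdivrMr; last by lra.
nra.
Qed.

(** Taking roots divides the relative error by m: Bernoulli's inequality bounds g above by f (1 +
    h/m), and [expr_le_half_root] bounds it below by f (1 - 2h/m). *)
Lemma root_perturbation (f g h : R) m : 0 <= f -> 0 <= g -> (0 < m)%N -> 0 <= h <= 1 / 2 ->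
  `|g ^+ m - f ^+ m| <= h * f ^+ m -> `|g - f| <= 2 * h / m%:R * f.
Proof.
move=> f0 g0 m_gt0 h01; have /andP[h0 h1] := h01.
have m0 : 0 < m%:R :> R by rewrite ltr0n.
have m1 : 1 <= m%:R :> R by rewrite ler1n.
have F0 : 0 <= f ^+ m by rewrite exprn_ge0.
set a := h / m%:R; have a0 : 0 <= a by rewrite divr_ge0 // ltW.
have aE : 2 * h / m%:R = 2 * a by rewrite mulrA.
have a1 : 2 * a <= 1 by rewrite -aE ler_pdivrMr // mul1r; lra.
have ub : f ^+ m * (1 + h) <= (f * (1 + a)) ^+ m.
  rewrite exprMn ler_wpM2l //; apply: le_trans (bernoulli _ _); last by lra.
  by rewrite /a mulrC divfK // gt_eqF.
have lb : (f * (1 - 2 * a)) ^+ m <= f ^+ m * (1 - h).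
  by rewrite exprMn ler_wpM2l // -aE; apply: expr_le_half_root.
rewrite ler_norml lerBlDr lerBrDr => /andP[gl gu].
have g_le : g <= f * (1 + a).
  rewrite -(@ler_pXn2r _ m) ?nnegrE // ?mulr_ge0 //; last by lra.
  by apply: le_trans ub; lra.
have g_ge : f * (1 - 2 * a) <= g.
  rewrite -(@ler_pXn2r _ m) ?nnegrE // ?mulr_ge0 //; last by lra.
  by apply: le_trans lb _; lra.
rewrite aE ler_norml; apply/andP; split; first by lra.
have : 0 <= f * a by rewrite mulr_ge0.
lra.
Qed.

Section Accuracy.
Variables (A f s v w : R) (m : nat).
Hypothesis s_small : 0 <= s <= 1 / 1000.
Hypothesis A_bounds : 1 / 2 <= A <= 1.
Hypothesis f_bounds : 0 <= f <= 1.
Hypothesis m_gt0 : (0 < m)%N.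
Hypothesis v_good : `|v - A| <= s.
Hypothesis w_good : `|w - A * f ^+ m| <= s.
Hypothesis fm_ge : 1 / 36 <= f ^+ m.

Let fm_le1 : f ^+ m <= 1.
Proof. by case/andP: f_bounds => f0 f1; apply: exprn_ile1. Qed.

Let v_bounds : A - s <= v <= A + s.
Proof. by move: v_good; rewrite ler_norml lerBlDr lerBrDr => /andP[]; lra. Qed.

Let w_bounds : A * f ^+ m - s <= w <= A * f ^+ m + s.
Proof. by move: w_good; rewrite ler_norml lerBlDr lerBrDr => /andP[]; lra. Qed.

Let v_gt0 : 0 < v.
Proof. by move: v_bounds A_bounds s_small => /andP[] + _ /andP[+ _] /andP[_]; lra. Qed.

Let w_gt0 : 0 < w.
Proof.
move: w_bounds A_bounds s_small fm_ge => /andP[+ _] /andP[+ _] /andP[_].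
by move: (f ^+ m) => F; nra.
Qed.

Let ratio_stepE : ratio_step m v w =
  if w <= v / 3 then Some (1 - (w / v) `^ (m%:R^-1)) else None.
Proof.
rewrite /ratio_step v_gt0 w_gt0 !andbT; case: ifP => // _.
by rewrite !leNgt v_gt0 w_gt0.
Qed.

(** If f^m <= 1/6, then w <= A/6 + s while v/3 >= (A - s)/3, and the gap A/6 >= 1/12 absorbs the
    errors. *)
Lemma ratio_step_none : ratio_step m v w = None -> 1 / 6 < f ^+ m.
Proof.
rewrite ratio_stepE; case: (leP w (v / 3)) => [_ //|wv _]; rewrite ltNge; apply/negP => F6.
have /andP[A1 _] := A_bounds; have A0 : 0 <= A by lra.
have := ler_wpM2l A0 F6.
move: v_bounds w_bounds s_small => /andP[+ _] /andP[_ +] /andP[_].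
by move: (A * f ^+ m) wv => F; lra.
Qed.

(* At the stopping length f^m is bounded away from 1, so that 1 / m <= 2 (1 - f):
   the additive error O(s / m) of the m-th root is a multiplicative error on 1 - f. *)
Lemma ratio_step_some y : ratio_step m v w = Some y ->
  `|y - (1 - f)| <= 720 * s * (1 - f).
Proof.
rewrite ratio_stepE; case: (leP w (v / 3)) => [wv [<-]|//].
have /andP[f0 f1] := f_bounds; have /andP[s0 s1] := s_small.
have m0 : 0 < m%:R :> R by rewrite ltr0n.
(* Were f^m above 1/2, then w >= A/2 - s would exceed v/3 <= (A + s)/3. *)
have F_half : f ^+ m <= 1 / 2.
  rewrite leNgt; apply/negP => /ltW F6.
  have /andP[A1 _] := A_bounds; have A0 : 0 <= A by lra.
  have := ler_wpM2l A0 F6.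
  move: v_bounds w_bounds s1 => /andP[_ +] /andP[+ _].
  by move: (A * f ^+ m) wv => F; lra.
set g := (w / v) `^ _.
have g0 : 0 <= g by apply: powR_ge0.
have gm : g ^+ m = w / v.
  rewrite -powR_mulrn // -powRrM mulVf ?gt_eqF // powRr1 //.
  by rewrite divr_ge0 // ltW.
have v25 : 2 / 5 <= v.
  by move: v_bounds A_bounds => /andP[+ _] /andP[+ _]; lra.
(* The numerator is at most 2 s in absolute value and f^m v >= (1/36)(2/5) = 1/90, whence 180. *)
have gf : `|g ^+ m - f ^+ m| <= (180 * s) * f ^+ m.
  have -> : g ^+ m - f ^+ m = (w - f ^+ m * v) / v.
    by rewrite gm; field; rewrite gt_eqF.
  rewrite normf_div (gtr0_norm v_gt0) ler_pdivrMr //.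
  apply: (@le_trans _ _ (2 * s)).
    have -> : w - f ^+ m * v = (w - A * f ^+ m) - f ^+ m * (v - A) by ring.
    apply: le_trans (ler_normB _ _) _; rewrite normrM (ger0_norm (exprn_ge0 _ f0)).
    have : f ^+ m * `|v - A| <= 1 * s by apply: ler_pM; rewrite ?exprn_ge0.
    by move: w_good; lra.
  have : 1 / 36 * (2 / 5) <= f ^+ m * v by apply: ler_pM => //; lra.
  move=> zz; rewrite -[180 * s * _ * v]mulrA; move: (f ^+ m * v) zz => z zz.
  rewrite -subr_ge0 (_ : _ - _ = s * (180 * z - 2)); last by ring.
  by apply: mulr_ge0 => //; lra.
(* [root_perturbation] doubles 180 s, and 1/m <= 2 (1 - f) doubles it again, to 720 s. *)
have h01 : 0 <= 180 * s <= 1 / 2 by lra.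
have fg := root_perturbation f0 g0 m_gt0 h01 gf.
have -> : 1 - g - (1 - f) = - (g - f) by ring.
rewrite normrN; apply: le_trans fg _.
have f1' : -1 <= - (1 - f) by lra.
have := bernoulli m f1'; rewrite (_ : 1 + - (1 - f) = f); last by ring.
move=> mf; have m2 : m%:R^-1 <= 2 * (1 - f).
  rewrite -[leLHS]mul1r ler_pdivrMr //; lra.
have im0 : 0 <= m%:R^-1 :> R by rewrite invr_ge0 ltW.
have : m%:R^-1 * f <= 2 * (1 - f) * 1 by apply: ler_pM.
move: (m%:R^-1) => i e.
rewrite -subr_ge0 (_ : _ - _ = 360 * (s * (2 * (1 - f) * 1 - i * f))); last by ring.
by rewrite !mulr_ge0 // subr_ge0.
Qed.

End Accuracy.

(** Since f <= e^(-(1 - f)), the power is at most e^(-5), and e^5 >= 1 + 5. *)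
Lemma expr_le_sixth f m : 0 <= f -> 5 <= m%:R * (1 - f) -> f ^+ m <= 1 / 6.
Proof.
move=> f0 mf; apply: (@le_trans _ _ (expR (- 5))).
  apply: (@le_trans _ _ (expR (- (1 - f)) ^+ m)).
    apply: lerXn2r; rewrite ?nnegrE ?expR_ge0 //.
    by apply: le_trans (expR_ge1Dx _); lra.
  by rewrite -expRM_natr ler_expR mulNr mulrC lerN2.
rewrite expRN div1r lef_pV2 ?posrE ?expR_gt0 //.
by apply: le_trans (expR_ge1Dx _); lra.
Qed.

End RatioStep.

(** * Propagation of the failure probability through loops and rounds *)

Section RatioAnalysis.
Variables (R : realType) (n : nat) (noise : gtm_noise R n).
Variables (X : {set pauli n}) (k t : nat) (s : R).
Hypothesis weak_noise : weak noise (1 / 2).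
Hypothesis stable_noise : stable noise (1 / 2).
Hypothesis k_gt0 : (0 < k)%N.
Hypothesis s_small : 0 <= s <= 1 / 1000.

Local Notation f := (eigenvalue_of noise).
Local Notation r_ := (infidelity_of noise).

Let q : R := 2 * expR (- (s ^+ 2 * t%:R / 32)).

Let q_ge0 : 0 <= q.
Proof. by rewrite mulr_ge0 ?expR_ge0. Qed.

(** The lengths used in a round up to j passes of its loop, including the length 0 of the call
    before the loop. Thus k lengths correspond to k - 1 passes, whence the recurring [k.-1]. *)
Definition lengths (j : nat) : seq nat := 0%N :: [seq (2 ^ i)%N | i <- iota 0 j].

Lemma mem_lengthsS j l : (l \in lengths j.+1) = (l == 2 ^ j)%N || (l \in lengths j).
Proof.
rewrite /lengths -[j.+1]addn1 iotaD map_cat -cat_cons mem_cat orbC add0n.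
by rewrite /= inE.
Qed.

Lemma uniq_lengths j : uniq (lengths j).
Proof.
rewrite /= map_inj_uniq ?iota_uniq ?andbT; last by move=> a b /eqP; rewrite eqn_exp2l // => /eqP.
by apply/mapP => -[i _ /esym/eqP]; rewrite expn_eq0.
Qed.

Lemma size_lengths j : size (lengths j) = j.+1.
Proof. by rewrite /= size_map size_iota. Qed.

Definition accurate (x : pauli n) (y : R) : Prop :=
  `|y - r_ x| <= 720 * s * r_ x.

Definition resolvable : Prop := forall x, x \in X -> 20 <= 2 ^+ k * r_ x.

Definition successful (out : option (estimate R n * seq nat)) : Prop :=
  (forall r kappa, out = Some (r, kappa) -> (num_lengths kappa <= k)%N ->
     forall x, x \in X -> exists2 y, r x = Some y & accurate x y) /\
  (resolvable -> exists r kappa, out = Some (r, kappa) /\ (num_lengths kappa <= k)%N).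

Definition failure (out : option (estimate R n * seq nat)) : R := (`[< ~ successful out >])%:R.

Lemma failure_le1 out : failure out <= 1.
Proof. by rewrite /failure; case: asbool. Qed.

(** [lengths k] has k + 1 elements, so the first clause of [successful] is vacuous; the second one
    is vacuous without resolvability. *)
Lemma failure_overflow r kappa : ~ resolvable -> {subset lengths k <= kappa} ->
  failure (Some (r, kappa)) <= 0.
Proof.
move=> nres sub; rewrite /failure asboolF // => -[]; split=> // r' kappa' [_ <-].
rewrite /num_lengths leqNgt => /negP[]; rewrite -size_lengths.
by apply: uniq_leq_size; [exact: uniq_lengths | move=> l /sub; rewrite mem_undup].
Qed.

Lemma expectation_run_v G X' m : stabilizer_group G ->
  expectation (run_v noise X' G t m).
Proof.
move=> Gs; apply: expectation_bind; last by move=> ?; apply: expectation_ret.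
exact/expectation_repeat/expectation_run_cb.
Qed.

Definition good_data (G : {group pauli n}) (X' : {set pauli n}) m (v : pauli n -> R) : Prop :=
  forall x, x \in X' :&: X -> `|v x - spam noise G x * f x ^+ m| <= s.

Lemma run_v_bad (G : {group pauli n}) (X' : {set pauli n}) m : stabilizer_group G -> X' \subset G ->
  probability (run_v noise X' G t m) (fun v => ~ good_data G X' m v) <= #|X' :&: X|%:R * q.
Proof.
move=> Gs /subsetP XG; have cbE := expectation_run_cb noise m Gs.
have rE := expectation_repeat t cbE.
apply: le_trans (@probability_union _ _ _ (X' :&: X) _
  (fun x (zs : seq (syndrome G)) =>
     ~ (`|t%:R^-1 * \sum_(z <- zs) syndrome_sign R x z - spam noise G x * f x ^+ m| <= s)) q rE _).
  rewrite /probability /run_v /bind /ret; apply: expectation_le => // zs.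
  rewrite ler_nat; case: asboolP => //= bad; rewrite lt0b; apply/asboolP.
  move: bad => /existsNP [x /not_implyP [xX xbad]]; exists x => //.
  by move: xbad; have /setIP [-> _] := xX.
move=> x /setIP [xX' _]; rewrite -run_cb_sign ?XG //.
apply: repeat_concentration => //; first exact: syndrome_sign_norm.
by move: s_small; lra.
Qed.

(** The sequential union bound: bad data at the current step cost e, and after good data the rest of
    the run costs at most B. *)
Lemma expectation_le_bad A (m : random R A) (good : A -> Prop) (h : A -> R) B e :
  expectation m -> probability m (fun a => ~ good a) <= e -> 0 <= B ->
  (forall a, h a <= 1) -> (forall a, good a -> h a <= B) -> m h <= e + B.
Proof.
move=> mE bad B0 h1 hB; have [mD _ _ _] := mE.
apply: (@le_trans _ _ (m (fun a => (`[< ~ good a >])%:R + B))).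
  apply: expectation_le => // a; case: asboolP => /= [_|/contrapT ga].
    by have := h1 a; lra.
  by rewrite add0r hB.
by rewrite mD (expectation_cst B mE) lerD2r.
Qed.

(** A bound along every path, resting on the fact that the list of lengths only grows. It handles
    runs that are bound to overflow and, with B = 1, the continuation after bad data. *)
Lemma ratio_while_sure fuel G X' v m r kappa h B : stabilizer_group G ->
  h None <= B -> (forall r' kappa', {subset kappa <= kappa'} -> h (Some (r', kappa')) <= B) ->
  ratio_while noise fuel X X' G t v m r kappa h <= B.
Proof.
move=> Gs hN; elim: fuel m r kappa => [|fuel IH] m r kappa hS /=; case: ifP => _.
- exact: hS.
- exact: hN.
- exact: hS.
- have vE := expectation_run_v X' m Gs.
  apply: bind_le => // w.
  apply: IH => r' kappa' sub; apply: hS => l lk; apply: sub; rewrite inE lk orbT //.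
Qed.

Lemma ratio_rounds_sure fuel O A r kappa h B :
  (forall G, G \in O -> stabilizer_group G) ->
  h None <= B -> (forall r' kappa', {subset kappa <= kappa'} -> h (Some (r', kappa')) <= B) ->
  ratio_rounds noise fuel O X A t r kappa h <= B.
Proof.
move=> + hN; elim: O A r kappa => [|G O IH] A r kappa Os hS /=; first exact: hS.
have Gs := Os G (mem_head _ _); have vE := expectation_run_v (G :\: A) 0 Gs.
apply: bind_le => // v; apply: ratio_while_sure => // r' kappa' sub.
apply: IH => [G' G'O|r'' kappa'' sub']; first by apply: Os; rewrite inE G'O orbT.
by apply: hS => l lk; apply/sub'/sub; rewrite inE lk orbT.
Qed.

Let f_bounds x : 1 / 2 <= f x <= 1.
Proof. exact: weak_noise. Qed.

Let f_bounds0 x : 0 <= f x <= 1.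
Proof. by have := f_bounds x; lra. Qed.

(* What accurate data and a missing estimate of x before the j-th pass say
   about f x. *)
Definition unresolved j x := j = 0%N \/ 1 / 6 < f x ^+ (2 ^ j.-1).

(** Doubling the length squares the power, and (1/6)^2 = 1/36; before the first pass, weak noise
    gives f >= 1/2. *)
Lemma unresolved_pow j x : unresolved j x -> 1 / 36 <= f x ^+ (2 ^ j).
Proof.
case=> [->|]; first by have := f_bounds x; rewrite expr1; lra.
case: j => [|j /=]; first by rewrite expr1; lra.
rewrite expnS mulnC exprM; move: (f x ^+ _) => z; nra.
Qed.

(** The last of k - 1 passes has length 2^(k-2). A power above 1/6 there means 2^(k-2) r_x < 5, that
    is 2^k r_x < 20; for k = 1 one has r_x <= 1/2. *)
Lemma unresolved_last x : x \in X -> unresolved k.-1 x -> ~ resolvable.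
Proof.
move=> xX ux res; have := res x xX; have /andP[f0 f1] := f_bounds0 x.
have /andP[fh _] := f_bounds x.
case: k k_gt0 ux => [//|[|k'] _ /= ux] hr.
  by move: hr; rewrite expr1 /infidelity_of; lra.
case: ux => // ux.
have : f x ^+ (2 ^ k') <= 1 / 6; last by lra.
apply: expr_le_sixth => //; move: hr; rewrite /infidelity_of natrX 2!exprS.
by move: (2 ^+ k') => z; lra.
Qed.

(** Here h stands for the rest of the protocol and B for its cost after a good loop; each pass still
    allowed costs one union bound over [X' :&: X]. If an element is pending after k - 1 passes with
    good data, the infidelities are not resolvable and the last hypothesis takes over. *)
Lemma ratio_while_bound fuel (G : {group pauli n}) (X' : {set pauli n}) j v r kappa (B : R) h :
  stabilizer_group G -> X' \subset G ->
  (forall x, x \in X' :&: X -> `|v x - spam noise G x| <= s) ->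
  (j <= k.-1)%N -> (k.-1 <= fuel + j)%N ->
  {subset lengths j <= kappa} -> {subset kappa <= lengths k.-1} ->
  (forall x, x \in X' :&: X -> r x = None -> unresolved j x) ->
  (forall x y, x \in X' :&: X -> r x = Some y -> accurate x y) ->
  (forall out, h out <= 1) -> 0 <= B ->
  (forall r' kappa', {subset kappa' <= lengths k.-1} ->
     (forall x, x \in X' :&: X -> exists2 y, r' x = Some y & accurate x y) ->
     (forall x, x \notin X' :&: X -> r' x = r x) -> h (Some (r', kappa')) <= B) ->
  (~ resolvable -> h None <= B /\
     forall r' kappa', {subset lengths k <= kappa'} -> h (Some (r', kappa')) <= B) ->
  ratio_while noise fuel X X' G t v (2 ^ j) r kappa h
    <= (k.-1 - j)%:R * (#|X' :&: X|%:R * q) + B.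
Proof.
move=> Gs XG vgood + + + + + + h1 B0.
set e := #|X' :&: X|%:R * q; have e0 : 0 <= e by rewrite mulr_ge0.
have step0 i : B <= i%:R * e + B by rewrite lerDr mulr_ge0.
elim: fuel j r kappa => [|fuel IH] j r kappa jk fk sub1 sub2 runres racc hgood hover /=.
  case: ifP => [/eqP p0|/negbT /set0Pn [x]].
    apply: le_trans (step0 _); apply: hgood => // x xX.
    case rx: (r x) => [y|]; first by exists y => //; apply: racc.
    by have : x \in [set x in X' :&: X | r x == None];
       [rewrite !inE -in_setI xX rx | rewrite p0 inE].
  rewrite inE => /andP[xX /eqP rx].
  have jE : j = k.-1 by apply/eqP; rewrite eqn_leq jk.
  have xX2 : x \in X by case/setIP: xX.
  have nres : ~ resolvable by apply: unresolved_last xX2 _; rewrite -jE; apply: runres.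
  by have [hN _] := hover nres; apply: le_trans (step0 _).
case: ifP => [/eqP p0|/negbT pend].
  apply: le_trans (step0 _); apply: hgood => // x xX.
  case rx: (r x) => [y|]; first by exists y => //; apply: racc.
  by have : x \in [set x in X' :&: X | r x == None];
     [rewrite !inE -in_setI xX rx | rewrite p0 inE].
have vE := expectation_run_v X' (2 ^ j) Gs.
(* A pass at j = k - 1 uses a (k+1)-st length, so the run overflows whatever its data are. *)
have [jlt|jge] := ltnP j k.-1; last first.
  have jE : j = k.-1 by apply/eqP; rewrite eqn_leq jk.
  have [x] := set0Pn _ pend; rewrite inE => /andP[xX /eqP rx].
  have xX2 : x \in X by case/setIP: xX.
  have nres : ~ resolvable by apply: unresolved_last xX2 _; rewrite -jE; apply: runres.
  have [hN hS] := hover nres.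
  apply: le_trans (step0 _); apply: bind_le => // w; apply: ratio_while_sure => // r' kappa' sub.
  apply: hS => l; rewrite -(prednK k_gt0) mem_lengthsS -jE => /orP[/eqP ->|lj].
    by apply: sub; rewrite mem_head.
  by apply: sub; rewrite inE sub1 ?orbT.
have -> : (k.-1 - j)%:R * e + B = e + ((k.-1 - j.+1)%:R * e + B).
  have kj : (k.-1 - j = 1 + (k.-1 - j.+1))%N by rewrite add1n subnSK.
  by rewrite kj natrD mulrDl mul1r addrA.
rewrite /bind; apply: (expectation_le_bad vE (run_v_bad _ Gs XG)).
- by apply: le_trans (step0 _).
- by move=> w; apply: ratio_while_sure.
move=> w wgood; rewrite -expnS.
have stepP x : x \in X' :&: X -> r x = None ->
    [/\ ratio_step (2 ^ j) (v x) (w x) = None -> 1 / 6 < f x ^+ (2 ^ j) &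
        forall y, ratio_step (2 ^ j) (v x) (w x) = Some y -> accurate x y].
  move=> xX rx; have xG : x \in G by case/setIP: xX => /(subsetP XG).
  have Ab : 1 / 2 <= spam noise G x <= 1.
    by apply/andP; split; [exact: stable_noise | exact: spam_le1].
  have m0 : (0 < 2 ^ j)%N by rewrite expn_gt0.
  have fp := unresolved_pow (runres x xX rx).
  split.
    exact: (ratio_step_none s_small Ab (vgood x xX) (wgood x xX) fp).
  by move=> y; apply: (ratio_step_some s_small Ab (f_bounds0 x) m0 (vgood x xX) (wgood x xX) fp).
have inp x : (x \in [set x in X' :&: X | r x == None]) = (x \in X' :&: X) && (r x == None).
  by rewrite inE.
apply: IH => //.
- by rewrite addnS -addSn.
- move=> l; rewrite mem_lengthsS => /orP[/eqP ->|lj]; first by rewrite mem_head.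
  by rewrite inE sub1 ?orbT.
- move=> l; rewrite inE => /orP[/eqP ->|]; last exact: sub2.
  by rewrite inE map_f ?orbT // mem_iota.
- move=> x xX; rewrite inp xX /=; case: eqP => [rx|//].
  by move=> st; right; have [+ _] := stepP x xX rx; apply.
- move=> x y xX; rewrite inp xX /=; case: eqP => [rx|_]; last exact: racc.
  by have [_ +] := stepP x xX rx; apply.
- move=> r' kappa' sub acc out'; apply: hgood => // x xX.
  by rewrite out' // inp (negPf xX).
Qed.

(** Induction over the groups, charging k q to each element of X not yet visited. Accuracy is an
    invariant of the visited elements because a later round works on [G :\: A] and leaves their
    estimates alone. *)
Lemma ratio_rounds_bound fuel (O : seq {group pauli n}) (A : {set pauli n}) r kappa :
  (k <= fuel)%N ->
  (forall G, G \in O -> stabilizer_group G) ->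
  (forall x, x \in X -> x \in A \/ exists2 G : {group pauli n}, G \in O & x \in G) ->
  {subset kappa <= lengths k.-1} ->
  (forall x, x \in X -> x \in A -> exists2 y, r x = Some y & accurate x y) ->
  (forall x, x \notin A -> r x = None) ->
  ratio_rounds noise fuel O X A t r kappa failure <= k%:R * (#|X :\: A|%:R * q).
Proof.
move=> kf; elim: O A r kappa => [|G O IH] A r kappa Os cov sub acc rN.
  rewrite /= /ret /failure asboolF; first by apply: mulr_ge0 => //; apply: mulr_ge0.
  move=> [].
  have num : (num_lengths kappa <= k)%N.
    rewrite -[leqRHS](prednK k_gt0) -size_lengths /num_lengths.
    by apply: uniq_leq_size; [exact: undup_uniq | move=> l; rewrite mem_undup; exact: sub].
  split; last by move=> _; exists r, kappa.
  move=> r' kappa' [<- _] _ x xX; apply: acc => //.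
  by have [//|[G]] := cov x xX; rewrite in_nil.
have Gs := Os G (mem_head _ _); have XG : G :\: A \subset G by apply: subsetDl.
have vE := expectation_run_v (G :\: A) 0 Gs.
have Os' G' : G' \in O -> stabilizer_group G' by move=> G'O; apply: Os; rewrite inE G'O orbT.
pose h out := (if out is Some (r', kappa') then
   ratio_rounds noise fuel O X (A :|: G) t r' kappa' else ret None) failure.
have h1 out : h out <= 1.
  case: out => [[r' kappa']|]; last exact: failure_le1.
  by apply: ratio_rounds_sure => // *; apply: failure_le1.
set B := k%:R * (#|X :\: (A :|: G)|%:R * q).
have B0 : 0 <= B by apply: mulr_ge0 => //; apply: mulr_ge0.
set e := #|(G :\: A) :&: X|%:R * q; have e0 : 0 <= e by rewrite mulr_ge0.
(* An element first met in G pays q for the length-0 data and q for each of k - 1 passes; the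
   remaining elements are left to B. *)
have -> : k%:R * (#|X :\: A|%:R * q) = e + (k.-1%:R * e + B).
  have -> : #|X :\: A| = (#|(G :\: A) :&: X| + #|X :\: (A :|: G)|)%N.
    rewrite -(cardsID G (X :\: A)) setDDl; congr (#|pred_of_set _| + _)%N.
    by apply/setP => x; rewrite !inE; case: (x \in G); case: (x \in A); case: (x \in X).
  rewrite natrD mulrDl mulrDr -/e -/B addrA; congr (_ + _).
  by rewrite -{1}(prednK k_gt0) -add1n natrD mulrDl mul1r.
rewrite -[leLHS]/(run_v noise (G :\: A) G t 0 (fun v =>
  ratio_while noise fuel X (G :\: A) G t v (2 ^ 0) r (0%N :: kappa) h)).
apply: (expectation_le_bad vE (run_v_bad _ Gs XG)).
- by apply: addr_ge0 => //; apply: mulr_ge0.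
- by move=> v; apply: ratio_while_sure => // *; apply: h1.
move=> v vgood.
have -> : k.-1%:R * e + B = (k.-1 - 0)%:R * e + B by rewrite subn0.
apply: (@ratio_while_bound fuel G (G :\: A) 0 v r _ B h) => //.
- by move=> x xX; have := vgood x xX; rewrite expr0 mulr1.
- by rewrite addn0 (leq_trans (leq_pred k)).
- by move=> l; rewrite /lengths /= !inE => ->.
- by move=> l; rewrite inE => /orP[/eqP ->|/sub //]; rewrite inE eqxx.
- by move=> x _ _; left.
- by move=> x y; rewrite !inE => /andP[/andP[xA _] _]; rewrite rN.
- move=> r' kappa' sub' acc' out'; apply: IH => // [x xX|x xX xAG|x xAG].
  + have [xA|[G' G'O xG']] := cov x xX; first by left; rewrite inE xA.
    move: G'O; rewrite inE => /orP[/eqP GG'|G'O]; last by right; exists G'.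
    by left; rewrite inE -GG' xG' orbT.
  + have [xA|xA] := boolP (x \in A).
      by rewrite out' ?inE ?xA //; apply: acc.
    by apply: acc'; move: xAG; rewrite !inE (negPf xA) xX /= => ->.
  + move: xAG; rewrite inE negb_or => /andP[xA xG].
    by rewrite out' ?rN // !inE (negPf xG) andbF.
- move=> nres; split.
    by rewrite /h /ret /failure asboolF // => -[]; split.
  move=> r' kappa' sub'; apply: le_trans B0; apply: ratio_rounds_sure => //.
    by rewrite /failure asboolF // => -[]; split.
  by move=> r'' kappa'' sub''; apply: failure_overflow => // l /sub' /sub''.
Qed.

Lemma ratio_failure fuel O : (k <= fuel)%N -> stabilizer_covering O X ->
  Defs.ratio noise fuel O X t failure <= k%:R * (#|X|%:R * q).
Proof.
move=> kf [_ Os cov].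
have := @ratio_rounds_bound fuel O set0 (fun=> None) [::] kf Os; rewrite setD0; apply=> //.
- by move=> x xX; right; apply: cov.
- by move=> x _; rewrite inE.
Qed.

Lemma expectation_ratio_while fuel (G : {group pauli n}) X' v m r kappa :
  stabilizer_group G -> expectation (ratio_while noise fuel X X' G t v m r kappa).
Proof.
move=> Gs; elim: fuel m r kappa => [|fuel IH] m r kappa /=; case: ifP => _.
- exact: expectation_ret.
- exact: expectation_ret.
- exact: expectation_ret.
- apply: expectation_bind => [|w]; [exact: expectation_run_v | exact: IH].
Qed.

Lemma expectation_ratio fuel (O : seq {group pauli n}) : (forall G, G \in O -> stabilizer_group G) ->
  expectation (Defs.ratio noise fuel O X t).
Proof.
rewrite /Defs.ratio; move: set0 (fun=> None) [::].
elim: O => [|G O IH] A r kappa Os /=; first exact: expectation_ret.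
have Gs := Os G (mem_head _ _).
apply: expectation_bind => [|v]; first exact: expectation_run_v.
apply: expectation_bind => [|[[r' kappa']|]]; first exact: expectation_ratio_while.
  by apply: IH => G' G'O; apply: Os; rewrite inE G'O orbT.
exact: expectation_ret.
Qed.

End RatioAnalysis.

(** * The estimator *)

Lemma ceiln_ge (R : realType) (x : R) : x <= (ceiln x)%:R.
Proof.
rewrite /ceiln natr_absz; apply: le_trans (Num.Theory.ceil_ge x) _.
by rewrite ler_int ler_norm.
Qed.

(** With s = 6 eps the exponent s^2 c / 32 is 36/32 times eps^2 c, which is at least ln z >= 0. *)
Lemma tail_ceiln_le (R : realType) (eps z : R) : 0 < eps -> 1 <= z ->
  2 * expR (- ((6 * eps) ^+ 2 * (ceiln (ln z / eps ^+ 2))%:R / 32)) <= 2 / z.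
Proof.
move=> e0 z1; have z0 : 0 < z by lra.
rewrite ler_pM2l // -[leRHS]lnK ?posrE ?invr_gt0 // ler_expR lnV ?posrE // lerN2.
have := ceiln_ge (ln z / eps ^+ 2); rewrite ler_pdivrMr ?exprn_gt0 //.
move: (ceiln _)%:R => c h; have lz : 0 <= ln z by rewrite ln_ge0.
have -> : (6 * eps) ^+ 2 * c / 32 = 36 / 32 * (c * eps ^+ 2) by field.
by move: (c * eps ^+ 2) h => u; lra.
Qed.

(** A linear substitute for intersecting events, which lets the two failure probabilities be
    subtracted one after the other. *)
Lemma indicator_sub_le (R : realDomainType) (P Q S : Prop) : (P -> Q -> S) ->
  (`[< P >])%:R + -1 * (`[< ~ Q >])%:R <= (`[< S >])%:R :> R.
Proof.
move=> PQS; case: (asboolP P) => [p|_]; case: (asboolP (~ Q)) => [_|/contrapT q] /=.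
- by rewrite mulr1 subrr ler0n.
- by rewrite asboolT ?mulr0 ?addr0 //; apply: PQS.
- by rewrite add0r mulr1; apply: le_trans (ler0n _ _); rewrite lerN10.
- by rewrite add0r mulr0 ler0n.
Qed.

(** Unlike [expectation_le], this compares only on the support, where the cardinality of the sample
    is known. *)
Lemma uniform_le (R : realType) (T : finType) (S : {set T}) (g h : T -> R) :
  (forall x, x \in S -> g x <= h x) -> uniform S g <= uniform S h.
Proof. by move=> gh; rewrite ler_wpM2l ?invr_ge0 ?ler0n // ler_sum. Qed.

(** The default 0 does not enter the error bound: accuracy supplies a value for every x in X. *)
Definition estimator (R : realType) n (X : {set pauli n}) (r : pauli n -> option R)
    (a : pauli n) : R :=
  (a == 0)%:R - #|X|%:R^-1 * \sum_(x in X) symp_sign R a x * odflt 0 (r x).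

Section Estimator.
Variables (R : realType) (n : nat) (noise : gtm_noise R n) (s : R).
Hypothesis weak_noise : weak noise (1 / 2).
Hypothesis s_ge0 : 0 <= s.
Local Notation r_ := (infidelity_of noise).
Local Notation p := (error_rate noise).

Let f_le1 a : eigenvalue_of noise a <= 1.
Proof. by case/andP: (weak_noise a). Qed.

Definition representative (E X : {set pauli n}) : Prop := forall a, a \in E ->
  `|#|X|%:R^-1 * (\sum_(x in X) symp_sign R a x * r_ x)
      - #|{: pauli n}|%:R^-1 * \sum_(x : pauli n) symp_sign R a x * r_ x|
    <= s * (2 * (1 - p 0)).

Lemma norm_symp_sign (a x : pauli n) : `|symp_sign R a x| = 1.
Proof. by rewrite /symp_sign normrX normrN1 expr1n. Qed.

(** In units of 2 (1 - p_0), which bounds every infidelity, the estimation errors contribute 720 s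
    and the sampling error s; hence 1442. *)
Lemma estimator_accurate (E X : {set pauli n}) (r : pauli n -> option R) :
  (0 < #|X|)%N -> representative E X ->
  (forall x, x \in X -> exists2 y, r x = Some y & accurate noise s x y) ->
  sup_dist E (estimator X r) p <= 1442 * s * (1 - p 0).
Proof.
move=> X_gt0 repr acc; have p0 := error_prob_ge0 f_le1.
have X0 : 0 < #|X|%:R :> R by rewrite ltr0n.
apply: bigmax_le => [|a aE]; first by rewrite !mulr_ge0.
have := repr a aE; rewrite (error_rate_infidelity noise a) card_pauli.
set m := (4 ^ n)%:R^-1 * _ => sample.
pose d := #|X|%:R^-1 * \sum_(x in X) symp_sign R a x * (odflt 0 (r x) - r_ x).
have dP : `|d| <= 720 * s * (2 * (1 - p 0)).
  rewrite normrM normfV (gtr0_norm X0) mulrC ler_pdivrMr //.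
  apply: le_trans (ler_norm_sum _ _ _) _; rewrite mulr_natr -sumr_const.
  apply: ler_sum => x /acc [y -> /= yP]; rewrite normrM norm_symp_sign mul1r.
  by apply: le_trans yP _; rewrite ler_wpM2l ?mulr_ge0 // infidelity_le.
have -> : estimator X r a - ((a == 0)%:R - m) =
   - (d + (#|X|%:R^-1 * (\sum_(x in X) symp_sign R a x * r_ x) - m)).
  have -> : d = #|X|%:R^-1 * (\sum_(x in X) symp_sign R a x * odflt 0 (r x))
              - #|X|%:R^-1 * (\sum_(x in X) symp_sign R a x * r_ x).
    by rewrite -mulrBr -sumrB; congr (_ * _); apply: eq_bigr => x _; rewrite mulrBr.
  rewrite /estimator; move: (#|X|%:R^-1 * _) (#|X|%:R^-1 * _) ((a == 0)%:R) => *; ring.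
rewrite normrN; apply: le_trans (ler_normD _ _) _.
apply: le_trans (lerD dP sample) _; rewrite le_eqVlt; apply/orP; left; apply/eqP.
by move: (p 0) => z; ring.
Qed.

Lemma representative_sample (E : {set pauli n}) K : (0 < K <= 4 ^ n)%N -> s <= 4 ->
  probability (@uniform R _ [set X : {set pauli n} | #|X| == K])
    (fun X => ~ representative E X)
  <= #|E|%:R * (2 * expR (- (s ^+ 2 * K%:R / 32))).
Proof.
move=> KP s4; have KP' : (0 < K <= #|{: pauli n}|)%N by rewrite card_pauli.
have SE : expectation (@uniform R _ [set X : {set pauli n} | #|X| == K]).
  apply: expectation_uniform; have /andP[_ K4] := KP'.
  by rewrite card_draws bin_gt0.
pose dev a (X : {set pauli n}) := 
  ~ (`|K%:R^-1 * (\sum_(x in X) symp_sign R a x * r_ x)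
      - #|{: pauli n}|%:R^-1 * \sum_(x : pauli n) symp_sign R a x * r_ x|
    <= s * (2 * (1 - p 0))).
apply: (@le_trans _ _ (probability (@uniform R _ [set X : {set pauli n} | #|X| == K])
    (fun X => exists2 a, a \in E & dev a X))).
  apply: uniform_le => X; rewrite inE => /eqP XK; rewrite ler_nat.
  case: asboolP => //= nrep; rewrite lt0b; apply/asboolP.
  move: nrep => /existsNP [a /not_implyP [aE adev]]; exists a => //.
  by move: adev; rewrite XK.
apply: probability_union => // a _; apply: sampling_concentration => //; last by rewrite s_ge0.
by move=> x; rewrite normrM norm_symp_sign mul1r ger0_norm ?infidelity_le ?infidelity_ge0.
Qed.

End Estimator.

Theorem theorem11 (R : realType) :
  exists C c eps0 delta0 : R,
    [/\ 0 < C, 0 < c, 0 < eps0 & 0 < delta0] /\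
    forall (n : nat) (E : {set pauli n}) (eps delta : R),
      0 < eps < eps0 -> 0 < delta < delta0 ->
      let K := ceiln (ln (4 * #|E|%:R / delta) / eps ^+ 2) in
      (K <= 4 ^ n)%N ->
      exists phat : {set pauli n} -> (pauli n -> option R) -> pauli n -> R,
        forall noise : gtm_noise R n,
          weak noise (1 / 2) -> stable noise (1 / 2) ->
          forall O : {set pauli n} -> seq {group pauli n},
            (forall X : {set pauli n}, #|X| = K ->
               stabilizer_covering (O X) X) ->
            forall k : nat, (0 < k)%N ->
              let t := ceiln (ln (4 * K%:R * k%:R / delta) / eps ^+ 2) in
              forall fuel : nat, (k <= fuel)%N ->
                1 - delta <=
                probability (experiment noise fuel K t O)
                  (fun '(X, out) =>
                     (forall (r : pauli n -> option R) (kappa : seq nat),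
                        out = Some (r, kappa) -> (num_lengths kappa <= k)%N ->
                        sup_dist E (phat X r) (error_rate noise)
                          <= C * eps * (1 - error_rate noise 0)) /\
                     ((forall x, x \in X -> c <= 2 ^+ k * infidelity_of noise x) ->
                        exists (r : pauli n -> option R) (kappa : seq nat),
                          out = Some (r, kappa) /\ (num_lengths kappa <= k)%N)).
Proof.
(* 8652 is 6 * 1442, as the data accuracy is s = 6 eps; eps < 1/6000 gives s <= 1/1000; 20 is the
   constant of [resolvable]; delta < 1 makes the arguments of the logarithms at least 1 when E and K
   are nontrivial. *)
exists 8652, 20, (1 / 6000), 1; split; first by split; lra.
move=> n E eps delta /andP[e0 e1] /andP[d0 d1] K K4.
exists (@estimator R n) => noise nweak nstable O cov k k0 t fuel kf.
pose s : R := 6 * eps; have s01 : 0 <= s <= 1 / 1000 by rewrite /s; lra.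
have s0 : 0 <= s by case/andP: s01.
have f1 a : eigenvalue_of noise a <= 1 by case/andP: (nweak a).
have p0 := error_prob_ge0 f1.
set U := @uniform R _ [set X : {set pauli n} | #|X| == K].
have UE : expectation U.
  by apply: expectation_uniform; rewrite card_draws card_pauli bin_gt0.
have K0 : (0 < #|E|)%N -> (0 < K)%N.
  move=> E0; rewrite lt0n; apply/eqP => KE.
  have := ceiln_ge (ln (4 * #|E|%:R / delta) / eps ^+ 2); rewrite -/K KE.
  rewrite leNgt => /negP[]; rewrite divr_gt0 ?exprn_gt0 // ln_gt0 //.
  rewrite ltr_pdivlMr // mul1r; have : 1 <= #|E|%:R :> R by rewrite ler1n.
  lra.
have ratio_fail (X : {set pauli n}) : #|X| = K ->
    Defs.ratio noise fuel (O X) X t (failure noise X k s) <= delta / 2.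
  move=> XK; apply: le_trans (ratio_failure t nweak nstable k0 s01 kf (cov X XK)) _.
  (* For K = 0 the failure bound is 0; otherwise it is at most K k * 2 delta / (4 K k) = delta /
     2. *)
  rewrite XK; have [->|Kpos] := posnP K; first by rewrite mul0r mulr0; lra.
  have Kk : 1 <= K%:R * k%:R :> R by rewrite -natrM ler1n muln_gt0 Kpos.
  have z1 : 1 <= 4 * K%:R * k%:R / delta.
    by rewrite ler_pdivlMr // mul1r -mulrA; lra.
  have Kk0 : 0 <= k%:R * K%:R :> R by rewrite mulr_ge0.
  rewrite mulrA; apply: le_trans (ler_wpM2l Kk0 (tail_ceiln_le e0 z1)) _.
  rewrite le_eqVlt; apply/orP; left; apply/eqP; field.
  by rewrite !pnatr_eq0 -!lt0n Kpos k0 gt_eqF.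
(* The sampling bound demands K > 0, which is guaranteed only for nonempty E; the implication sets
   the empty case aside. *)
have sample_fail : probability U (fun X => ~ (E != set0 -> representative noise s E X)) <= delta / 2.
  have [E0|Epos] := eqVneq E set0.
    rewrite (_ : probability _ _ = 0) ?divr_ge0 ?ltW //.
    rewrite -[RHS](expectation_cst 0 UE); congr U; apply/funext => X.
    by rewrite asboolF // => -[].
  have E1 : (0 < #|E|)%N by rewrite card_gt0.
  have z1 : 1 <= 4 * #|E|%:R / delta.
    have : 1 <= #|E|%:R :> R by rewrite ler1n.
    by rewrite ler_pdivlMr // mul1r; lra.
  have E0 : 0 <= #|E|%:R :> R by [].
  apply: (@le_trans _ _ (probability U (fun X => ~ representative noise s E X))).
    apply: uniform_le => X _; rewrite ler_nat; case: asboolP => //= h.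
    by rewrite lt0b; apply/asboolP => h'; apply: h.
  have KP : (0 < K <= 4 ^ n)%N by rewrite K0.
  have s4 : s <= 4 by case/andP: s01; lra.
  apply: le_trans (representative_sample nweak s0 E KP s4) _.
  apply: le_trans (ler_wpM2l E0 (tail_ceiln_le e0 z1)) _.
  rewrite le_eqVlt; apply/orP; left; apply/eqP; field.
  by rewrite pnatr_eq0 -lt0n E1 gt_eqF.
have {sample_fail} sample_ok : 1 - delta / 2 <=
    probability U (fun X => E != set0 -> representative noise s E X).
  by move: sample_fail; rewrite probabilityC //; lra.
(* One half of delta is spent on the sampling; the half subtracted here under the average is the
   allowance for a failure of Ratio at each X. *)
apply: (@le_trans _ _ (U (fun X =>
   (`[< E != set0 -> representative noise s E X >])%:R + - (delta / 2)))).
  have [UD _ _ _] := UE; rewrite UD (expectation_cst _ UE).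
  by move: sample_ok; rewrite /probability; lra.
rewrite /probability /experiment {2}/bind; apply: uniform_le => X; rewrite inE => /eqP XK.
have [_ Os _] := cov X XK; have RE := expectation_ratio noise X t fuel Os.
have [RD RZ _ _] := RE.
apply: (@le_trans _ _ (Defs.ratio noise fuel (O X) X t (fun out =>
   (`[< E != set0 -> representative noise s E X >])%:R + -1 * failure noise X k s out))).
  by rewrite RD RZ (expectation_cst _ RE) lerD2l; have := ratio_fail X XK; lra.
rewrite /bind /ret; apply: expectation_le => // out.
apply: indicator_sub_le => rep [acc term]; split=> // r kappa oE num.
have [E0|Epos] := eqVneq E set0.
  by rewrite /sup_dist E0 big_set0 !mulr_ge0 // ltW.
have Xpos : (0 < #|X|)%N by rewrite XK K0 // card_gt0.
have := estimator_accurate nweak s0 Xpos (rep Epos) (acc r kappa oE num).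
move=> /le_trans; apply; rewrite /s.
by rewrite le_eqVlt; apply/orP; left; apply/eqP; move: (error_rate noise 0) => z; ring.
Qed.
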